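(* Let $\mathcal F=(F_1,F_2)$ be a pair of finite sets of positive integers and $\alpha,\beta$ real numbers satisfying (A1) and (A2). Assume $$\alpha+k+1>0,\qquad\beta+k_1-k_2+1>0,\qquad\Omega^{\alpha,\beta}_{\mathcal F}(x)\neq0\ \text{for all }x\in[-1,1].$$ Then $\alpha,\beta,\mathcal F$ are Jacobi admissible.
   Context: $(a)_0=1$, $(a)_j=a(a+1)\cdots(a+j-1)$. Jacobi polynomials: $P^{a,b}_n(x)=2^{-n}\sum_{j=0}^n\binom{n+a}{j}\binom{n+b}{n-j}(x-1)^{n-j}(x+1)^j$. A pair $\mathcal F=(F_1,F_2)$ consists of finite sets of positive integers, not both empty, $F_i=\{f^{(i)}_1<\dots<f^{(i)}_{k_i}\}$, $k=k_1+k_2$. (A1): $\alpha,\beta,\alpha+\beta\notin\{-1,-2,\dots\}$. (A2): if $F_2\ne\emptyset$, then $\alpha-\beta\notin\{-1,-2,\dots\}$ and $\beta-f^{(2)}_{k_2}-1\notin\{-1,-2,\dots\}$. $\Omega^{\alpha,\beta}_{\mathcal F}(x)=\det W(x)/(1+x)^{k_2(k_2-1)}$, with $W(x)$ the $k\times k$ matrix (columns $j=1..k$) with rows $((-1)^{j-1}(P^{\alpha,\beta}_f)^{(j-1)}(x))_j$ for $f\in F_1$ increasing, then $((\beta-f)_{j-1}(1+x)^{k-j}P^{\alpha+j-1,-\beta-j+1}_f(x))_j$ for $f\in F_2$ increasing. Jacobi admissibility: with $\mathcal H^{\alpha,\beta}_{\mathcal F}(x)=\prod_{f\in F_1}(x-f)(x+f+\alpha+\beta+1)\prod_{f\in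 F_2}(x+\beta-f)(x+f+\alpha+1)\cdot\frac{\Gamma(x+\alpha+1)\Gamma(x+\beta+1)}{(2x+\alpha+\beta+1)\Gamma(x+\alpha+\beta+1)}$, $\alpha,\beta,\mathcal F$ are Jacobi admissible if $\mathcal H^{\alpha,\beta}_{\mathcal F}(x)\ge0$ for all $x\in\mathbb N=\{0,1,2,\dots\}$. *)

(* Defs.v *)
From Stdlib Require Import Reals List Sorted Classical ClassicalEpsilon Factorial.
From Stdlib Require Import Arith.
Import ListNotations.
Open Scope R_scope.

Definition poly := list R.

Fixpoint peval (p : poly) (x : R) : R :=
  match p with nil => 0 | c :: q => c + x * peval q x end.

Fixpoint padd (p q : poly) : poly :=
  match p, q with
  | nil, _ => q
  | _, nil => p
  | a :: p', b :: q' => (a + b) :: padd p' q'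
  end.

Definition pscale (c : R) (p : poly) : poly := map (fun a => c * a) p.

Fixpoint pmul (p q : poly) : poly :=
  match p with nil => nil | a :: p' => padd (pscale a q) (0 :: pmul p' q) end.

Fixpoint ppow (p : poly) (n : nat) : poly :=
  match n with O => [1] | S n' => pmul p (ppow p n') end.

Definition psum (l : list poly) : poly := fold_right padd nil l.

Fixpoint pderiv_aux (k : nat) (q : poly) : poly :=
  match q with nil => nil | c :: q' => (INR k * c) :: pderiv_aux (S k) q' end.
Definition pderiv (p : poly) : poly := pderiv_aux 1 (tl p).
Definition pderivn (j : nat) (p : poly) : poly := Nat.iter j pderiv p.

Definition pX_minus_1 : poly := [-1; 1].
Definition pX_plus_1 : poly := [1; 1].

(* synthetic division by (x+1): returns (quotient, remainder) *)
Fixpoint pdivX1 (p : poly) : poly * R :=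
  match p with
  | nil => (nil, 0)
  | c0 :: p' => let (q', r') := pdivX1 p' in (r' :: q', c0 - r')
  end.
Definition pdivX1n (m : nat) (p : poly) : poly :=
  Nat.iter m (fun q => fst (pdivX1 q)) p.

Definition remove_nth {A} (j : nat) (l : list A) : list A :=
  firstn j l ++ skipn (S j) l.

Fixpoint pdet (n : nat) (M : list (list poly)) : poly :=
  match n with
  | O => [1]
  | S n' =>
    match M with
    | nil => nil
    | row :: rest =>
      psum (map (fun j => pmul (pscale ((-1) ^ j) (nth j row nil))
                               (pdet n' (map (remove_nth j) rest)))
                (seq 0 n))
    end
  end.

Definition prodR (l : list R) : R := fold_right Rmult 1 l.

Definition poch (a : R) (j : nat) : R := prodR (map (fun i => a + INR i) (seq 0 j)).

Definition gbinom (r : R) (j : nat) : R :=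
  prodR (map (fun i => r - INR i) (seq 0 j)) / INR (fact j).

Definition jacobiP (a b : R) (n : nat) : poly :=
  pscale (/ 2 ^ n)
    (psum (map (fun j => pscale (gbinom (INR n + a) j * gbinom (INR n + b) (n - j))
                                (pmul (ppow pX_minus_1 (n - j)) (ppow pX_plus_1 j)))
               (seq 0 (S n)))).

Definition W_row1 (a b : R) (k f : nat) : list poly :=
  map (fun j => pscale ((-1) ^ (j - 1)) (pderivn (j - 1) (jacobiP a b f)))
      (seq 1 k).

Definition W_row2 (a b : R) (k f : nat) : list poly :=
  map (fun j => pscale (poch (b - INR f) (j - 1))
                       (pmul (ppow pX_plus_1 (k - j))
                             (jacobiP (a + INR j - 1) (- b - INR j + 1) f)))
      (seq 1 k).

Definition Wmat (a b : R) (F1 F2 : list nat) : list (list poly) :=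
  let k := (length F1 + length F2)%nat in
  map (W_row1 a b k) F1 ++ map (W_row2 a b k) F2.

(* Omega^{a,b}_F = det W / (1+x)^{k2(k2-1)}  (an exact polynomial division) *)
Definition Omega (a b : R) (F1 F2 : list nat) : poly :=
  let k2 := length F2 in
  pdivX1n (k2 * (k2 - 1)) (pdet (length F1 + length F2) (Wmat a b F1 F2)).

Definition Gamma_seq (z : R) (n : nat) : R :=
  INR (fact n) * Rpower (INR n) z / prodR (map (fun i => z + INR i) (seq 0 (S n))).

Definition Gamma (z : R) : R :=
  epsilon (inhabits 0) (fun g => Un_cv (Gamma_seq z) g).

Definition not_neg_int (t : R) : Prop := forall m : nat, t <> - INR (S m).

Definition condA1 (a b : R) : Prop :=
  not_neg_int a /\ not_neg_int b /\ not_neg_int (a + b).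

Definition condA2 (a b : R) (F2 : list nat) : Prop :=
  F2 <> nil ->
  not_neg_int (a - b) /\ not_neg_int (b - INR (last F2 O) - 1).

Definition Hfun (a b : R) (F1 F2 : list nat) (x : R) : R :=
  prodR (map (fun f => (x - INR f) * (x + INR f + a + b + 1)) F1) *
  prodR (map (fun f => (x + b - INR f) * (x + INR f + a + 1)) F2) *
  (Gamma (x + a + 1) * Gamma (x + b + 1) /
   ((2 * x + a + b + 1) * Gamma (x + a + b + 1))).

Definition jacobi_admissible (a b : R) (F1 F2 : list nat) : Prop :=
  forall x : nat, 0 <= Hfun a b F1 F2 (INR x).

Definition pos_finset (F : list nat) : Prop :=
  Sorted lt F /\ Forall (fun f => (0 < f)%nat) F.

(* Main.v *)
(* The rows of W are, up to powers of 1+x, the successive derivatives of the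
   seed functions P_f^{a,b} (f in F1) and (1+x)^{-b} P_f^{a,-b} (f in F2), all
   eigenfunctions of the Jacobi operator, so Omega is their Wronskian up to a
   power of 1+x.  The chain of Darboux transformations along the seeds sends P_n
   to a function y_k which satisfies
     (1-x^2)^k y_k^2 w = c P_n^2 w + (w g)',   w = (1-x)^a (1+x)^b,
   where c is the product of the eigenvalue differences, that is, the product
   over F1 and F2 in H(n), and g is a rational function.  Modulo derivatives
   P_n^2 w reduces to a multiple of (1-x^2)^N w, N large, whose coefficient has
   the sign of the Gamma quotient in H(n).  Hence
     (1-x^2)^k y_k^2 w = C (1-x^2)^N w + (w g)'
   where C has the sign of H(n).
   If C < 0, then w g increases strictly.  The poles of the intermediate
   transformations cancel: Omega is the only denominator of y_k in (-1,1), and a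
   rational g with a pole there would make (w g)'/w have a pole of higher order.
   At the ends +-1 the same comparison of orders shows that w g tends to 0, even
   when w is not integrable.  This is a contradiction, so C >= 0. *)

(* As only alpha + k + 1 and beta + k1 - k2 + 1 are known to be positive, the norm integrals of P_n
   and of the intermediate functions may diverge. They are never formed: all identities hold between
   rational functions, modulo (w g)'/w, with (1-x^2)^N w, N >= k, as the reference. The two
   positivity conditions match the orders at the ends: (1-x^2)^k y_k^2 has order at least k at 1 and
   at least k - 2 k2 = k1 - k2 at -1, where y_k has a pole of order at most k2, and integration adds
   one. The chain needs nonzero transformed seeds, although intermediate Wronskians may vanish
   inside (-1,1). At the ends 1-x^2 vanishes, and the equation alone shows that a Darboux step
   preserves nonvanishing when eigenvalues differ. (A1) and (A2) provide distinct eigenvalues and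
   seeds that are nonzero at the ends. The constant C is explicit: n differentiations turn P_n^2
   into a constant multiple of (1-x^2)^n, and the Beta recurrence raises the exponent to N. Its
   factors are Pochhammer products long enough to fix the signs of the Gamma values. *)
Require Import Defs.
From Stdlib Require Import Reals List.
From Stdlib Require Import Factorial ZArith Sorted Lra Lia ClassicalEpsilon.

(** * Real analysis and the Gamma function *)

Section RealAnalysis.
Local Open Scope R_scope.

Lemma Rpower_small (A eps : R) : 0 < A -> 0 < eps ->
  exists d, 0 < d /\ forall t, 0 < t <= d -> Rpower t A <= eps.
Proof.
intros HA He; exists (Rpower eps (/ A)); split; [apply exp_pos|].
intros t [Ht1 Ht2]; replace eps with (Rpower (Rpower eps (/ A)) A).
- apply Rle_Rpower_l; lra.
- rewrite Rpower_mult, Rinv_l, Rpower_1; lra.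
Qed.

Lemma Rpower_le_max (B t : R) : 0 < B -> 0 < t <= 2 -> Rpower t B <= Rpower 2 B.
Proof. intros HB Ht; apply Rle_Rpower_l; lra. Qed.

(* The function vanishes at both ends of the interval, so it cannot increase. *)
Lemma vanishing_ends_not_increasing (A B M : R) (h : R -> R) :
  0 < A -> 0 < B -> (forall x, -1 <= x <= 1 -> Rabs (h x) <= M) ->
  let G := fun x => Rpower (1 - x) A * Rpower (1 + x) B * h x in
  (forall a b, -1 < a -> a < b -> b < 1 -> G a < G b) -> False.
Proof.
intros HA HB HM G HG.
assert (M0 : 0 <= M) by (eapply Rle_trans; [apply Rabs_pos|apply (HM 0); lra]).
(* Here u is the power of the distance to the near end, v the other power, w a value of h. The bound
   on u makes the product at most D/2; the 1 in the denominator keeps it positive when C M = 0. *)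
assert (bnd : forall C D u v w, 0 < u -> 0 < v -> 0 <= C -> u <= D / (2 * (C * M + 1)) -> v <= C ->
  Rabs w <= M -> 0 < D -> Rabs (u * v * w) < D).
{ intros C D u v w Hu Hv HC HuD HvC Hw HD.
  rewrite !Rabs_mult, (Rabs_pos_eq u), (Rabs_pos_eq v) by lra.
  assert (CM : 0 <= C * M) by (apply Rmult_le_pos; lra).
  assert (E : v * Rabs w <= C * M) by (apply Rmult_le_compat; try lra; apply Rabs_pos).
  assert (E2 : u * (2 * (C * M + 1)) <= D).
  { apply Rle_trans with (D / (2 * (C * M + 1)) * (2 * (C * M + 1))).
    - apply Rmult_le_compat_r; lra.
    - right; field; lra. }
  assert (E3 : u * (v * Rabs w) <= u * (C * M)) by (apply Rmult_le_compat_l; lra).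
  nra. }
(* A positive value of G could only grow towards 1, where G tends to 0. The assertion [pos] is the
   mirror image at -1. *)
assert (neg : forall x, -1 < x < 1 -> G x <= 0).
{ intros x Hx; apply Rnot_lt_le; intro Gx.
  set (C := Rpower 2 B); assert (C0 : 0 < C) by apply exp_pos.
  assert (CM : 0 <= C * M) by (apply Rmult_le_pos; lra).
  destruct (Rpower_small A (G x / (2 * (C * M + 1))) HA) as [d [Hd Hs]].
  { apply Rdiv_lt_0_compat; lra. }
  set (t := Rmin d ((1 - x) / 2)).
  assert (t0 : 0 < t) by (unfold t; apply Rmin_glb_lt; lra).
  assert (td : t <= d) by apply Rmin_l.
  assert (tx : t <= (1 - x) / 2) by apply Rmin_r.
  assert (I : G x < G (1 - t)) by (apply HG; lra).
  assert (S : Rabs (G (1 - t)) < G x).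
  { unfold G at 1; replace (1 - (1 - t)) with t by ring.
    apply (bnd C); try (apply exp_pos); try lra.
    - apply Hs; lra.
    - apply Rpower_le_max; lra.
    - apply HM; lra. }
  generalize (Rle_abs (G (1 - t))); lra. }
assert (pos : forall x, -1 < x < 1 -> 0 <= G x).
{ intros x Hx; apply Rnot_lt_le; intro Gx.
  set (C := Rpower 2 A); assert (C0 : 0 < C) by apply exp_pos.
  assert (CM : 0 <= C * M) by (apply Rmult_le_pos; lra).
  destruct (Rpower_small B (- G x / (2 * (C * M + 1))) HB) as [d [Hd Hs]].
  { apply Rdiv_lt_0_compat; lra. }
  set (t := Rmin d ((1 + x) / 2)).
  assert (t0 : 0 < t) by (unfold t; apply Rmin_glb_lt; lra).
  assert (td : t <= d) by apply Rmin_l.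
  assert (tx : t <= (1 + x) / 2) by apply Rmin_r.
  assert (I : G (t - 1) < G x) by (apply HG; lra).
  assert (S : Rabs (G (t - 1)) < - G x).
  { unfold G at 1; replace (1 + (t - 1)) with t by ring.
    rewrite (Rmult_comm (Rpower _ A)).
    apply (bnd C); try (apply exp_pos); try lra.
    - apply Hs; lra.
    - apply Rpower_le_max; lra.
    - apply HM; lra. }
  generalize (Rle_abs (- G (t - 1))); rewrite Rabs_Ropp; lra. }
generalize (HG 0 (1/2)) (neg (1/2)) (pos 0); lra.
Qed.

Lemma derivable_pt_lim_weighted (A B x h' : R) (h : R -> R) :
  -1 < x < 1 -> derivable_pt_lim h x h' ->
  derivable_pt_lim (fun x => Rpower (1 - x) A * Rpower (1 + x) B * h x) x
    (Rpower (1 - x) A * Rpower (1 + x) B * ((- A / (1 - x) + B / (1 + x)) * h x + h')).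
Proof.
intros Hx Hh.
assert (P : forall C s, s = 1 \/ s = -1 ->
  derivable_pt_lim (fun x => Rpower (1 + s * x) C) x (Rpower (1 + s * x) C * (C * s / (1 + s * x)))).
{ intros C s Hs; assert (0 < 1 + s * x) by (destruct Hs; subst; lra).
  replace (Rpower (1 + s * x) C * (C * s / (1 + s * x)))
    with (Rpower (1 + s * x) C * (C / (1 + s * x)) * s) by (field; lra).
  apply (derivable_pt_lim_comp (fun x => 1 + s * x) (fun y => Rpower y C)).
  - assert (D : derivable_pt_lim (fct_cte 1 + mult_real_fct s id)%F x (0 + s * 1)).
    { apply derivable_pt_lim_plus; [apply derivable_pt_lim_const|].
      apply derivable_pt_lim_scal, derivable_pt_lim_id. }
    replace (0 + s * 1) with s in D by ring; exact D.
  - replace (Rpower (1 + s * x) C * (C / (1 + s * x))) with (C * Rpower (1 + s * x) (C - 1)).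
    + apply derivable_pt_lim_power; assumption.
    + unfold Rminus; rewrite Rpower_plus, Rpower_Ropp, Rpower_1 by assumption; field; lra. }
assert (E : forall y, Rpower (1 - y) A * Rpower (1 + y) B * h y =
   Rpower (1 + -1 * y) A * Rpower (1 + 1 * y) B * h y).
{ intro y; replace (1 - y) with (1 + -1 * y) by ring; replace (1 + 1 * y) with (1 + y) by ring; reflexivity. }
apply derivable_pt_lim_ext with (fun y => Rpower (1 + -1 * y) A * Rpower (1 + 1 * y) B * h y).
{ intro y; symmetry; apply E. }
replace (1 - x) with (1 + -1 * x) by ring; replace (1 + x) with (1 + 1 * x) by ring.
generalize (P A (-1) (or_intror eq_refl)) (P B 1 (or_introl eq_refl)); intros DA DB.
generalize (derivable_pt_lim_mult _ _ _ _ _ (derivable_pt_lim_mult _ _ _ _ _ DA DB) Hh).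
unfold mult_fct; intro D.
match type of D with derivable_pt_lim _ _ ?l => match goal with |- derivable_pt_lim _ _ ?m =>
  replace m with l; [exact D|] end end.
field; lra.
Qed.

(** With u = ln (1+t), take exp s >= 1+s at s = -z u and s = (1-z) u with weights 1-z and z: the
    linear terms cancel, and multiplication by exp (z u) gives the claim. *)
Lemma Rpower_bernoulli (z t : R) : 0 <= z <= 1 -> -1 < t -> Rpower (1 + t) z <= 1 + z * t.
Proof.
intros Hz Ht; unfold Rpower; set (u := ln (1 + t)).
assert (Eu : exp u = 1 + t) by (unfold u; apply exp_ln; lra).
generalize (exp_ineq1_le (- (z * u))) (exp_ineq1_le ((1 - z) * u)); intros H1 H2.
assert (H3 : 1 <= (1 - z) * exp (- (z * u)) + z * exp ((1 - z) * u)) by nra.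
assert (E1 : exp (z * u) * exp (- (z * u)) = 1) by (rewrite <- exp_plus; replace (z * u + - (z * u)) with 0 by ring; apply exp_0).
assert (E2 : exp (z * u) * exp ((1 - z) * u) = 1 + t) by (rewrite <- exp_plus, <- Eu; f_equal; ring).
assert (H4 := Rmult_le_compat_l (exp (z * u)) _ _ (Rlt_le _ _ (exp_pos _)) H3).
replace (exp (z * u) * ((1 - z) * exp (- (z * u)) + z * exp ((1 - z) * u)))
  with ((1 - z) * (exp (z * u) * exp (- (z * u))) + z * (exp (z * u) * exp ((1 - z) * u))) in H4 by ring.
rewrite E1, E2 in H4; lra.
Qed.

Lemma prodR_app l1 l2 : prodR (l1 ++ l2) = prodR l1 * prodR l2.
Proof. unfold prodR; induction l1; simpl; [ring|rewrite IHl1; ring]. Qed.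

Lemma poch_S z n : poch z (S n) = poch z n * (z + INR n).
Proof. unfold poch; rewrite seq_S, map_app, prodR_app; unfold prodR at 2; simpl fold_right; simpl plus; ring. Qed.

Lemma poch_shift z n : z * poch (z + 1) n = poch z (S n).
Proof.
induction n as [|n IH].
- rewrite poch_S; unfold poch; simpl; ring.
- rewrite poch_S, (poch_S z (S n)), <- IH, S_INR; ring.
Qed.

Lemma poch_neq0 z n : (forall m : nat, z <> - INR m) -> poch z n <> 0.
Proof.
intros Hz; induction n as [|n IH].
- unfold poch; simpl; lra.
- rewrite poch_S; apply Rmult_integral_contrapositive; split; [exact IH|].
  specialize (Hz n); lra.
Qed.

Lemma poch_pos z n : 0 < z -> 0 < poch z n.
Proof.
intros Hz; induction n as [|n IH].
- unfold poch; simpl; lra.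
- rewrite poch_S; apply Rmult_lt_0_compat; [exact IH|generalize (pos_INR n); lra].
Qed.

Lemma Gamma_seqE z n : Gamma_seq z n = INR (fact n) * Rpower (INR n) z / poch z (S n).
Proof. reflexivity. Qed.

(** The ratio of consecutive terms is estimated by Bernoulli at t = -1/(N+1). Index 0 is left out
    because [Rpower 0 z] is a default value. *)
Lemma Gamma_seq_growing z n : 0 < z <= 1 -> Gamma_seq z (S n) <= Gamma_seq z (S (S n)).
Proof.
intros Hz; rewrite !Gamma_seqE, (poch_S z (S (S n))).
set (N := INR (S n)); assert (HN : 0 < N) by (apply lt_0_INR; lia).
assert (R0 := poch_pos z (S (S n)) (proj1 Hz)); set (r := poch z (S (S n))) in *.
assert (F0 : 0 < INR (fact (S n))) by (apply lt_0_INR, lt_O_fact).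
rewrite (fact_simpl (S n)), mult_INR, (S_INR (S n)); fold N.
set (F := INR (fact (S n))) in *.
assert (B := Rpower_bernoulli z (- / (N + 1)) ltac:(lra)).
assert (I1 : 0 < / (N + 1) < 1).
{ split; [apply Rinv_0_lt_compat; lra|].
  rewrite <- Rinv_1 at 2; apply Rinv_lt_contravar; lra. }
specialize (B ltac:(lra)).
replace (1 + - / (N + 1)) with (N / (N + 1)) in B by (field; lra).
assert (P1 : Rpower N z = Rpower (N + 1) z * Rpower (N / (N + 1)) z).
{ rewrite Rpower_mult_distr by (try lra; apply Rdiv_lt_0_compat; lra).
  f_equal; field; lra. }
assert (P0 : 0 < Rpower (N + 1) z) by apply exp_pos.
rewrite P1; set (Q := Rpower (N + 1) z) in *; set (q := Rpower (N / (N + 1)) z) in *.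
assert (q0 : 0 < q) by apply exp_pos.
assert (K : q * (N + 1 + z) <= N + 1).
{ assert (E : (1 + z * - / (N + 1)) * (N + 1 + z) <= N + 1).
  { replace ((1 + z * - / (N + 1)) * (N + 1 + z)) with (N + 1 - z * z * / (N + 1)) by (field; lra).
    assert (0 <= z * z * / (N + 1)) by (apply Rmult_le_pos; nra). lra. }
  apply Rle_trans with (2 := E); apply Rmult_le_compat_r; lra. }
assert (FQr : 0 < F * Q * / (r * (z + (N + 1)))).
{ apply Rmult_lt_0_compat; [nra|apply Rinv_0_lt_compat; nra]. }
replace (F * (Q * q) / r) with (F * Q * / (r * (z + (N + 1))) * (q * (N + 1 + z))) by (field; lra).
replace ((N + 1) * F * Q / (r * (z + (N + 1)))) with (F * Q * / (r * (z + (N + 1))) * (N + 1)) by (field; lra).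
apply Rmult_le_compat_l; lra.
Qed.

(** With n+1 in place of n in the power, Gauss's sequence decreases from its value 1/z at n = 0. It
    dominates [Gamma_seq], which is thereby bounded. *)
Lemma Gamma_seq_bounded z n : 0 < z <= 1 ->
  INR (fact n) * Rpower (INR (S n)) z / poch z (S n) <= / z.
Proof.
intros Hz; induction n as [|n IH].
- rewrite poch_S; unfold poch; simpl; unfold Rpower; rewrite ln_1, Rmult_0_r, exp_0.
  right; field; lra.
- apply Rle_trans with (2 := IH); rewrite (poch_S z (S n)).
  set (N := INR (S n)); assert (HN : 0 < N) by (apply lt_0_INR; lia).
  assert (R0 := poch_pos z (S n) (proj1 Hz)); set (r := poch z (S n)) in *.
  assert (F0 : 0 < INR (fact n)) by (apply lt_0_INR, lt_O_fact).
  rewrite (fact_simpl n), mult_INR, (S_INR (S n)); fold N.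
  set (F := INR (fact n)) in *.
  assert (I1 : 0 < / N) by (apply Rinv_0_lt_compat; lra).
  assert (B := Rpower_bernoulli z (/ N) ltac:(lra) ltac:(lra)).
  replace (1 + / N) with ((N + 1) / N) in B by (field; lra).
  assert (P1 : Rpower (N + 1) z = Rpower N z * Rpower ((N + 1) / N) z).
  { rewrite Rpower_mult_distr by (try lra; apply Rdiv_lt_0_compat; lra).
    f_equal; field; lra. }
  assert (P0 : 0 < Rpower N z) by apply exp_pos.
  rewrite P1; set (Q := Rpower N z) in *; set (q := Rpower ((N + 1) / N) z) in *.
  assert (K : N * q <= z + N).
  { apply Rle_trans with (N * (1 + z * / N)); [apply Rmult_le_compat_l; lra|].
    right; field; lra. }
  assert (FQr : 0 < F * Q * / (r * (z + N))).
  { apply Rmult_lt_0_compat; [nra|apply Rinv_0_lt_compat; nra]. }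
  replace (N * F * (Q * q) / (r * (z + N))) with (F * Q * / (r * (z + N)) * (N * q)) by (field; lra).
  replace (F * Q / r) with (F * Q * / (r * (z + N)) * (z + N)) by (field; lra).
  apply Rmult_le_compat_l; lra.
Qed.

Lemma Un_cv_S (u : nat -> R) l : Un_cv (fun n => u (S n)) l -> Un_cv u l.
Proof.
intros H eps He; destruct (H eps He) as [N HN]; exists (S N); intros [|n] Hn; [lia|].
apply HN; lia.
Qed.

Lemma Gamma_seq_cv_base z : 0 < z <= 1 -> exists l, Un_cv (Gamma_seq z) l.
Proof.
intros Hz; destruct (growing_cv (fun n => Gamma_seq z (S n))) as [l Hl].
- intro n; apply Gamma_seq_growing; exact Hz.
- exists (/ z); intros x [n ->].
  apply Rle_trans with (2 := Gamma_seq_bounded z (S n) Hz).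
  rewrite Gamma_seqE; apply Rmult_le_compat_r.
  + left; apply Rinv_0_lt_compat, poch_pos; lra.
  + apply Rmult_le_compat_l; [apply pos_INR|].
    apply Rle_Rpower_l; [lra|split; [apply lt_0_INR; lia|apply le_INR; lia]].
- exists l; apply Un_cv_S; exact Hl.
Qed.

(** Gamma(z+1) = z Gamma(z) before the limit. The correction factor tends to 1, so convergence
    passes in both directions. *)
Lemma Gamma_seq_shift z n : (forall m : nat, z <> - INR m) ->
  Gamma_seq (z + 1) (S n) * (1 + (z + 1) * / INR (S n)) = z * Gamma_seq z (S n).
Proof.
intros Hz; rewrite !Gamma_seqE.
assert (HN : 0 < INR (S n)) by (apply lt_0_INR; lia).
assert (z0 : z <> 0) by (intro E; apply (Hz 0%nat); simpl; lra).
assert (E : z * poch (z + 1) (S (S n)) = poch z (S (S n)) * (z + 1 + INR (S n))).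
{ rewrite poch_shift, poch_S, (S_INR (S n)); ring. }
assert (R1 := poch_neq0 z (S (S n)) Hz).
assert (R2 : poch (z + 1) (S (S n)) <> 0).
{ intro R2; apply (poch_neq0 z (S (S (S n))) Hz); rewrite <- poch_shift, R2; ring. }
rewrite Rpower_plus, Rpower_1 by assumption.
assert (E' : poch (z + 1) (S (S n)) = poch z (S (S n)) * (z + 1 + INR (S n)) / z).
{ rewrite <- E; field; exact z0. }
assert (z1 : z + 1 + INR (S n) <> 0).
{ specialize (Hz (S (S n))); rewrite S_INR in Hz; lra. }
rewrite E'; field; repeat split; try assumption; lra.
Qed.

Lemma Un_cv_cst c : Un_cv (fun _ => c) c.
Proof. intros eps He; exists 0%nat; intros; unfold Rdist; rewrite Rminus_diag, Rabs_R0; exact He. Qed.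

Lemma cv_one_plus_inv c : Un_cv (fun n => 1 + c * / INR (S n)) 1.
Proof.
assert (Z : Un_cv (fun n => / INR (S n)) 0).
{ intros eps He; destruct (archimed_cor1 eps He) as [N [HN HN0]]; exists N; intros n Hn.
  unfold Rdist; rewrite Rminus_0_r, Rabs_pos_eq by (left; apply Rinv_0_lt_compat, lt_0_INR; lia).
  apply Rle_lt_trans with (2 := HN); apply Rinv_le_contravar; [apply lt_0_INR; lia|apply le_INR; lia]. }
assert (H := CV_plus _ _ _ _ (Un_cv_cst 1) (CV_mult _ _ _ _ (Un_cv_cst c) Z)).
replace (1 + c * 0) with 1 in H by ring; exact H.
Qed.

Lemma Un_cv_shift_down (u : nat -> R) l : Un_cv u l -> Un_cv (fun n => u (S n)) l.
Proof. intros H eps He; destruct (H eps He) as [N HN]; exists N; intros n Hn; apply HN; lia. Qed.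

Lemma Gamma_seq_cv_down z : (forall m : nat, z <> - INR m) ->
  (exists l, Un_cv (Gamma_seq (z + 1)) l) -> exists l, Un_cv (Gamma_seq z) l.
Proof.
intros Hz [l Hl]; assert (z0 : z <> 0) by (intro E; apply (Hz 0%nat); simpl; lra).
exists (/ z * (l * 1)); apply Un_cv_S.
apply Un_cv_ext with (fun n => / z * (Gamma_seq (z + 1) (S n) * (1 + (z + 1) * / INR (S n)))).
- intro n; rewrite Gamma_seq_shift by exact Hz; field; exact z0.
- apply (CV_mult (fun _ => / z)); [apply Un_cv_cst|].
  apply (CV_mult (fun n => Gamma_seq (z + 1) (S n))); [|apply cv_one_plus_inv].
  apply Un_cv_shift_down; exact Hl.
Qed.

Lemma Gamma_seq_cv_up z : (forall m : nat, z <> - INR m) ->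
  (exists l, Un_cv (Gamma_seq z) l) -> exists l, Un_cv (Gamma_seq (z + 1)) l.
Proof.
intros Hz [l Hl]; exists (z * l * / 1); apply Un_cv_S.
assert (nz : forall n, 1 + (z + 1) * / INR (S n) <> 0).
{ intros n E; assert (HN : 0 < INR (S n)) by (apply lt_0_INR; lia).
  apply (Hz (S (S n))); rewrite S_INR.
  assert (E2 : (1 + (z + 1) * / INR (S n)) * INR (S n) = 0) by (rewrite E; ring).
  replace ((1 + (z + 1) * / INR (S n)) * INR (S n)) with (INR (S n) + (z + 1)) in E2 by (field; lra).
  lra. }
apply Un_cv_ext with (fun n => (z * Gamma_seq z (S n)) * / (1 + (z + 1) * / INR (S n))).
- intro n; rewrite <- Gamma_seq_shift by exact Hz; field; split.
  + apply Rgt_not_eq, lt_0_INR; lia.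
  + intro E; apply (nz n); field_simplify; [|apply Rgt_not_eq, lt_0_INR; lia].
    replace (z + INR (S n) + 1) with 0 by lra; unfold Rdiv; ring.
- apply (CV_mult (fun n => z * Gamma_seq z (S n)) (fun n => / (1 + (z + 1) * / INR (S n)))).
  + apply (CV_mult (fun _ => z) (fun n => Gamma_seq z (S n))); [apply Un_cv_cst|].
    apply Un_cv_shift_down; exact Hl.
  + apply (continuity_seq Rinv); [|apply cv_one_plus_inv].
    apply (continuity_pt_inv id); [apply derivable_continuous_pt, derivable_pt_id|unfold id; lra].
Qed.

(** An integer shift brings z into (0,1], where the sequence is monotone and bounded. Existence of
    the limit is what makes the [epsilon] in [Gamma] return it. *)
Lemma Gamma_seq_cv z : (forall m : nat, z <> - INR m) -> exists l, Un_cv (Gamma_seq z) l.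
Proof.
assert (down : forall n z, (forall m : nat, z <> - INR m) -> 0 < z + INR n <= 1 ->
  exists l, Un_cv (Gamma_seq z) l).
{ induction n as [|n IH]; intros w Hw Hn.
  - apply Gamma_seq_cv_base; simpl in Hn; lra.
  - apply Gamma_seq_cv_down; [exact Hw|]; apply IH.
    + intros m E; apply (Hw (S m)); rewrite S_INR; lra.
    + rewrite S_INR in Hn; lra. }
assert (upw : forall n z, 0 < z - INR n <= 1 -> exists l, Un_cv (Gamma_seq z) l).
{ induction n as [|n IH]; intros w Hn.
  - apply Gamma_seq_cv_base; simpl in Hn; lra.
  - rewrite S_INR in Hn; replace w with ((w - 1) + 1) by ring; apply Gamma_seq_cv_up.
    + intros m E; generalize (pos_INR m) (pos_INR n); lra.
    + apply IH; lra. }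
intros Hz; destruct (archimed (- z)) as [A1 A2]; set (m := up (- z)) in *.
assert (bnd : 0 < z + IZR m <= 1) by lra.
destruct (Z_le_gt_dec 0 m) as [Hm|Hm].
- apply (down (Z.to_nat m)); [exact Hz|]; rewrite INR_IZR_INZ, Z2Nat.id; assumption.
- apply (upw (Z.to_nat (- m))).
  rewrite INR_IZR_INZ, Z2Nat.id, opp_IZR by lia; lra.
Qed.

(** All factors of the Pochhammer product beyond the M-th are positive, so every late term of
    Gauss's sequence has the sign of [poch z M]. The limit keeps a weak sign; the value zero is
    dealt with where the Gamma quotient is formed. *)
Lemma Gamma_sign z M : (forall m : nat, z <> - INR m) -> 0 < z + INR M ->
  0 <= Gamma z * poch z M.
Proof.
intros Hz HM.
assert (Hc : Un_cv (Gamma_seq z) (Gamma z)).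
{ unfold Gamma; apply epsilon_spec; apply Gamma_seq_cv; exact Hz. }
assert (P : forall i, 0 < poch z (M + i) * poch z M).
{ induction i as [|i IH].
  - rewrite Nat.add_0_r; generalize (poch_neq0 z M Hz); nra.
  - rewrite Nat.add_succ_r, poch_S, plus_INR.
    replace (poch z (M + i) * (z + (INR M + INR i)) * poch z M)
      with (poch z (M + i) * poch z M * (z + (INR M + INR i))) by ring.
    apply Rmult_lt_0_compat; [exact IH|generalize (pos_INR i); lra]. }
assert (C := CV_mult _ (fun _ => poch z M) _ _ Hc (Un_cv_cst _)).
apply Rnot_lt_le; intro L.
destruct (C (- (Gamma z * poch z M)) ltac:(lra)) as [N HN].
specialize (HN (M + N)%nat ltac:(lia)); unfold Rdist in HN.
assert (S0 : 0 <= Gamma_seq z (M + N) * poch z M).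
{ rewrite Gamma_seqE, <- Nat.add_succ_r; specialize (P (S N)).
  assert (R0 := poch_neq0 z (M + S N) Hz); set (r := poch z (M + S N)) in *.
  replace (INR (fact (M + N)) * Rpower (INR (M + N)) z / r * poch z M)
    with (INR (fact (M + N)) * Rpower (INR (M + N)) z * (r * poch z M * (/ r * / r))) by (field; exact R0).
  apply Rmult_le_pos; [apply Rmult_le_pos; [apply pos_INR|left; apply exp_pos]|].
  apply Rmult_le_pos; [lra|]; apply Rle_0_sqr. }
apply Rabs_def2 in HN; lra.
Qed.

End RealAnalysis.

From mathcomp Require Import all_boot all_order all_algebra.
From mathcomp Require Import zify ring lra.
From mathcomp Require Import Rstruct.
Set Implicit Arguments. Unset Strict Implicit. Unset Printing Implicit Defensive.
Import Order.TTheory GRing.Theory Num.Theory.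
Local Open Scope ring_scope.

(** * Rational functions and their local behaviour *)

Section FractionDerivation.
Variable F : fieldType.
Local Notation K := {fraction {poly F}}.
Local Notation "p %:F" := (@FracField.tofrac {poly F} p).

Lemma fraction_mul_denom (x : K) : x * (\d_(repr x))%:F = (\n_(repr x))%:F.
Proof.
rewrite -[X in X * _](reprK x); move: (repr x) => r.
unlock FracField.tofrac; rewrite -[LHS]FracField.pi_mul.
apply/eqmodP; rewrite /= FracField.equivfE /FracField.mulf.
by rewrite !numden_Ratio ?mulf_neq0 ?oner_neq0 ?denom_ratioP // !mulr1 mulrC.
Qed.

Lemma fraction_numden (x : K) : x = (\n_(repr x))%:F / (\d_(repr x))%:F.
Proof.
have d0 : (\d_(repr x))%:F != 0 by rewrite tofrac_eq0 denom_ratioP.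
by apply: (mulIf d0); rewrite mulfVK // fraction_mul_denom.
Qed.

Definition frac_deriv (x : K) : K :=
  let p := \n_(repr x) in let q := \d_(repr x) in
  (p^`() * q - p * q^`())%:F / (q * q)%:F.

(** Independence of the representative: n/m = p/q means n q = p m, and differentiating this relation
    identifies the two quotient rules. *)
Lemma frac_derivE (p q : {poly F}) : q != 0 ->
  frac_deriv (p%:F / q%:F) = (p^`() * q - p * q^`())%:F / (q * q)%:F.
Proof.
move=> q0; rewrite /frac_deriv.
have := fraction_numden (p%:F / q%:F).
set n := \n_ _; set m := \d_ _ => E.
have m0 : m != 0 by apply: denom_ratioP.
have {}E : n * q = p * m.
  by move/eqP: E; rewrite eqr_div ?tofrac_eq0 // -!tofracM tofrac_eq => /eqP ->.
have E' : n^`() * q + n * q^`() = p^`() * m + p * m^`() by rewrite -!derivM E.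
apply/eqP; rewrite eqr_div ?tofrac_eq0 ?mulf_neq0 // -!tofracM tofrac_eq; apply/eqP.
transitivity (m * q * (n^`() * q + n * q^`()) - (n * q) * (m^`() * q + m * q^`())).
  by move: n^`() m^`() q^`() => a b c; ring.
by rewrite E' E; move: p^`() m^`() q^`() => a b c; ring.
Qed.

Lemma frac_deriv_tofrac p : frac_deriv p%:F = p^`()%:F.
Proof.
have := @frac_derivE p 1 (oner_neq0 _).
by rewrite tofrac1 divr1 derivC mulr0 subr0 !mulr1 tofrac1 divr1.
Qed.

End FractionDerivation.

Section QuotientRule.
Variables (F K : fieldType) (j : {rmorphism {poly F} -> K}) (D : K -> K).
Hypothesis jI : injective j.
Hypothesis fracP : forall x : K, exists p q : {poly F}, q != 0 /\ x = j p / j q.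
Hypothesis DE : forall p q : {poly F}, q != 0 ->
  D (j p / j q) = j (p^`() * q - p * q^`()) / j (q * q).

Let j_neq0 p : p != 0 -> j p != 0.
Proof. by rewrite -(rmorph0 j) (inj_eq jI). Qed.

Lemma quotient_ruleD x y : D (x + y) = D x + D y.
Proof.
have [p [q [q0 ->]]] := fracP x; have [r [t [t0 ->]]] := fracP y.
rewrite addf_div ?j_neq0 // -!rmorphM -rmorphD !DE ?mulf_neq0 //.
rewrite !rmorphB !derivD !derivM !rmorphM !rmorphD !rmorphM.
have := j_neq0 q0; have := j_neq0 t0.
move: (j q^`()) (j t^`()) (j p^`()) (j r^`()) (j p) (j q) (j r) (j t) => a b a' b' p' q' r' t' ? ?.
by field; apply/andP.
Qed.

Lemma quotient_ruleM x y : D (x * y) = D x * y + x * D y.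
Proof.
have [p [q [q0 ->]]] := fracP x; have [r [t [t0 ->]]] := fracP y.
rewrite mulf_div -!rmorphM !DE ?mulf_neq0 //.
rewrite !rmorphB !derivM !rmorphM !rmorphD !rmorphM.
have := j_neq0 q0; have := j_neq0 t0.
move: (j q^`()) (j t^`()) (j p^`()) (j r^`()) (j p) (j q) (j r) (j t) => a b a' b' p' q' r' t' ? ?.
by field; apply/andP.
Qed.

End QuotientRule.

(* Working over this abstract interface keeps unification away from the
   quotient construction of [{fraction {poly F}}]. *)
Record ratfield (F : fieldType) := RatField {
  rf_field :> fieldType;
  rf_inj : {rmorphism {poly F} -> rf_field};
  rf_injI : injective rf_inj;
  rf_frac : forall x : rf_field,
    exists p q : {poly F}, q != 0 /\ x = rf_inj p / rf_inj q;
  rf_d : rf_field -> rf_field;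
  rf_dD : forall x y, rf_d (x + y) = rf_d x + rf_d y;
  rf_dM : forall x y, rf_d (x * y) = rf_d x * y + x * rf_d y;
  rf_dinj : forall p, rf_d (rf_inj p) = rf_inj p^`() }.

Lemma ratfield_exists (F : fieldType) : inhabited (ratfield F).
Proof.
have injF : injective (@FracField.tofrac {poly F}).
  by move=> p q /eqP; rewrite tofrac_eq => /eqP.
have surjF (x : {fraction {poly F}}) : exists p q : {poly F}, q != 0 /\
    x = FracField.tofrac p / FracField.tofrac q.
  by exists \n_(repr x), \d_(repr x); rewrite denom_ratioP -fraction_numden.
constructor.
apply: (@RatField F {fraction {poly F}} (@FracField.tofrac {poly F}) injF surjF (@frac_deriv F)).
- exact: quotient_ruleD injF surjF (@frac_derivE F).
- exact: quotient_ruleM injF surjF (@frac_derivE F).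
- exact: frac_deriv_tofrac.
Qed.

Section LocalTheory.
Variables (F : fieldType) (K : ratfield F).
Local Notation j := (@rf_inj F K).
Local Notation d := (@rf_d F K).
Definition rf_cst (c : F) : K := j c%:P.
Definition rf_X : K := j 'X.

Lemma cst0 : rf_cst 0 = 0. Proof. by rewrite /rf_cst rmorph0. Qed.
Lemma cst1 : rf_cst 1 = 1. Proof. by rewrite /rf_cst rmorph1. Qed.
Lemma cstD a b : rf_cst (a + b) = rf_cst a + rf_cst b. Proof. by rewrite /rf_cst !rmorphD. Qed.
Lemma cstN a : rf_cst (- a) = - rf_cst a. Proof. by rewrite /rf_cst !rmorphN. Qed.
Lemma cstB a b : rf_cst (a - b) = rf_cst a - rf_cst b. Proof. by rewrite cstD cstN. Qed.
Lemma cstM a b : rf_cst (a * b) = rf_cst a * rf_cst b. Proof. by rewrite /rf_cst !rmorphM. Qed.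
Lemma cstX a n : rf_cst (a ^+ n) = rf_cst a ^+ n. Proof. by rewrite /rf_cst !rmorphXn. Qed.
Lemma cst_nat n : rf_cst n%:R = n%:R. Proof. by rewrite /rf_cst !rmorph_nat. Qed.

Lemma rf_inj_eq0 p : (j p == 0) = (p == 0).
Proof. by rewrite -(rmorph0 j) (inj_eq (@rf_injI _ K)). Qed.

Lemma cst_eq0 a : (rf_cst a == 0) = (a == 0).
Proof. by rewrite rf_inj_eq0 polyC_eq0. Qed.

Lemma d0 : d 0 = 0. Proof. by rewrite -(rmorph0 j) rf_dinj raddf0. Qed.
Lemma d_cst c : d (rf_cst c) = 0. Proof. by rewrite rf_dinj derivC rmorph0. Qed.
Lemma d1 : d 1 = 0. Proof. by rewrite -cst1 d_cst. Qed.
Lemma dX : d rf_X = 1. Proof. by rewrite rf_dinj derivX rmorph1. Qed.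
Lemma dN x : d (- x) = - d x.
Proof. by rewrite -mulN1r rf_dM -cst1 -cstN d_cst mul0r add0r cstN cst1 mulN1r. Qed.
Lemma dB x y : d (x - y) = d x - d y. Proof. by rewrite rf_dD dN. Qed.
Lemma dV (x : K) : x != 0 -> d x^-1 = - d x / x ^+ 2.
Proof.
move=> x0; apply: (mulfI x0).
have := rf_dM x x^-1; rewrite divff // d1 => /eqP; rewrite eq_sym addrC addr_eq0 => /eqP ->.
by field.
Qed.

(** A value is a relation because an element of [K] is an abstract fraction: some representative has
    a denominator that is nonzero at c. Then [reg c] is the local ring at c and [unitat c] its group
    of units. *)
Definition ev (c : F) (f : K) (v : F) :=
  exists p q : {poly F}, [/\ q.[c] != 0, f = j p / j q & v = p.[c] / q.[c]].
Definition reg c f := exists v, ev c f v.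
Definition unitat c f := exists2 v, v != 0 & ev c f v.

Lemma horner_neq0 (q : {poly F}) c : q.[c] != 0 -> j q != 0.
Proof. by apply: contraNneq => /eqP; rewrite rf_inj_eq0 => /eqP ->; rewrite horner0. Qed.

Lemma ev_uniq c f v w : ev c f v -> ev c f w -> v = w.
Proof.
move=> [p [q [q0 -> ->]]] [r [t [t0 /eqP E ->]]].
move: E; rewrite eqr_div ?(horner_neq0 q0) ?(horner_neq0 t0) // -!rmorphM.
move/eqP/(@rf_injI _ K) => E; apply/eqP; rewrite eqr_div //.
by rewrite -!hornerM E.
Qed.

Lemma evD c f g v w : ev c f v -> ev c g w -> ev c (f + g) (v + w).
Proof.
move=> [p [q [q0 -> ->]]] [r [t [t0 -> ->]]].
exists (p * t + r * q), (q * t); split; first by rewrite hornerM mulf_neq0.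
  by rewrite addf_div ?(horner_neq0 q0) ?(horner_neq0 t0) // !rmorphD !rmorphM.
by rewrite addf_div // !hornerE.
Qed.

Lemma evM c f g v w : ev c f v -> ev c g w -> ev c (f * g) (v * w).
Proof.
move=> [p [q [q0 -> ->]]] [r [t [t0 -> ->]]].
exists (p * r), (q * t); split; first by rewrite hornerM mulf_neq0.
  by rewrite mulf_div // !rmorphM.
by rewrite mulf_div // !hornerE.
Qed.

Lemma ev_inj c p : ev c (j p) p.[c].
Proof. by exists p, 1; rewrite hornerC oner_neq0 rmorph1 !divr1. Qed.

Lemma ev_cst c a : ev c (rf_cst a) a.
Proof. by have := ev_inj c a%:P; rewrite hornerC. Qed.
Lemma ev_nat c n : ev c n%:R n%:R.
Proof. by rewrite -[X in ev _ X]cst_nat; exact: ev_cst. Qed.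
Lemma ev0 c : ev c 0 0. Proof. by rewrite -cst0; apply: ev_cst. Qed.
Lemma ev1 c : ev c 1 1. Proof. by rewrite -cst1; apply: ev_cst. Qed.

Lemma evX c : ev c rf_X c.
Proof. by have := ev_inj c 'X; rewrite hornerX. Qed.

Lemma evN c f v : ev c f v -> ev c (- f) (- v).
Proof. by move=> h; rewrite -mulN1r -[- v]mulN1r -cst1 -cstN; apply: evM => //; apply: ev_cst. Qed.

Lemma evB c f g v w : ev c f v -> ev c g w -> ev c (f - g) (v - w).
Proof. by move=> hf hg; apply: evD => //; apply: evN. Qed.

Lemma evXn c f v n : ev c f v -> ev c (f ^+ n) (v ^+ n).
Proof.
by move=> h; elim: n => [|n IH]; [rewrite !expr0; apply: ev1|rewrite !exprS; apply: evM].
Qed.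

Lemma evV c f v : ev c f v -> v != 0 -> ev c f^-1 v^-1.
Proof.
move=> [p [q [q0 -> ->]]] v0; exists q, p; split; rewrite ?invf_div //.
by apply: contraNneq v0 => ->; rewrite mul0r.
Qed.

Lemma ev_neq0 c f v : ev c f v -> v != 0 -> f != 0.
Proof. by move=> h; apply: contraNneq => E; apply/eqP; apply: ev_uniq h _; rewrite E; apply: ev0. Qed.

Lemma reg_d c f : reg c f -> reg c (d f).
Proof.
move=> [_ [p [q [q0 -> _]]]].
exists ((p^`() * q - p * q^`()).[c] / (q * q).[c]).
exists (p^`() * q - p * q^`()), (q * q); split=> //; first by rewrite hornerM mulf_neq0.
have qj := horner_neq0 q0.
by rewrite rf_dM dV // !rf_dinj rmorphB !rmorphM; field.
Qed.

Lemma regD c f g : reg c f -> reg c g -> reg c (f + g).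
Proof. by move=> [v hv] [w hw]; exists (v + w); apply: evD. Qed.
Lemma regM c f g : reg c f -> reg c g -> reg c (f * g).
Proof. by move=> [v hv] [w hw]; exists (v * w); apply: evM. Qed.
Lemma regN c f : reg c f -> reg c (- f).
Proof. by move=> [v hv]; exists (- v); apply: evN. Qed.
Lemma regB c f g : reg c f -> reg c g -> reg c (f - g).
Proof. by move=> ? ?; apply: regD => //; apply: regN. Qed.
Lemma regXn c f n : reg c f -> reg c (f ^+ n).
Proof. by move=> [v hv]; exists (v ^+ n); apply: evXn. Qed.
Lemma reg_inj c p : reg c (j p). Proof. by exists p.[c]; apply: ev_inj. Qed.
Lemma reg_cst c a : reg c (rf_cst a). Proof. exact: reg_inj. Qed.
Lemma reg_X c : reg c rf_X. Proof. exact: reg_inj. Qed.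
Lemma reg0 c : reg c 0. Proof. by exists 0; apply: ev0. Qed.
Lemma reg1 c : reg c 1. Proof. by exists 1; apply: ev1. Qed.
Lemma reg_nat c n : reg c n%:R. Proof. by exists n%:R; apply: ev_nat. Qed.

Lemma unitat_reg c f : unitat c f -> reg c f. Proof. by move=> [v _ h]; exists v. Qed.
Lemma unitat_neq0 c f : unitat c f -> f != 0.
Proof. by move=> [v v0 h]; apply: ev_neq0 h v0. Qed.
Lemma unitatM c f g : unitat c f -> unitat c g -> unitat c (f * g).
Proof. by move=> [v v0 hv] [w w0 hw]; exists (v * w); [rewrite mulf_neq0|apply: evM]. Qed.
Lemma unitatV c f : unitat c f -> unitat c f^-1.
Proof. by move=> [v v0 hv]; exists v^-1; [rewrite invr_eq0|apply: evV]. Qed.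
Lemma unitat1 c : unitat c 1. Proof. by exists 1; [apply: oner_neq0|apply: ev1]. Qed.
Lemma unitatXn c f n : unitat c f -> unitat c (f ^+ n).
Proof. by move=> h; elim: n => [|n IH]; [apply: unitat1|rewrite exprS; apply: unitatM]. Qed.
Lemma unitat_exprz c f (n : int) : unitat c f -> unitat c (f ^ n).
Proof. by move=> h; case: n => n; [|rewrite NegzE -exprnN; apply: unitatV]; apply: unitatXn. Qed.
Lemma regV c f : unitat c f -> reg c f^-1.
Proof. by move=> /unitatV/unitat_reg. Qed.

Lemma dlogM (x y : K) : x != 0 -> y != 0 -> d (x * y) / (x * y) = d x / x + d y / y.
Proof. move=> x0 y0; rewrite rf_dM; by field; rewrite x0 y0. Qed.
Lemma dXn (x : K) n : d (x ^+ n.+1) = n.+1%:R * x ^+ n * d x.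
Proof.
elim: n => [|n IH]; first by rewrite expr1 expr0 !mul1r.
by rewrite exprS rf_dM IH (exprS x n) -[n.+2]addn1 natrD; ring.
Qed.
Lemma dlogXz (x : K) (n : int) : x != 0 -> d (x ^ n) / x ^ n = n%:~R * (d x / x).
Proof.
move=> x0; have P (m : nat) : d (x ^+ m) / x ^+ m = m%:R * (d x / x).
  case: m => [|m]; first by rewrite expr0 d1 !mul0r.
  by rewrite dXn exprS; field; rewrite expf_neq0 ?x0.
case: n => n; first by rewrite -exprnP P.
rewrite NegzE -exprnN mulrNz mulNr -[n.+1%:~R]/(n.+1%:R) -P dV ?expf_neq0 //.
by field; rewrite expf_neq0 ?oner_neq0.
Qed.

Definition rf_lin (c : F) : K := rf_X - rf_cst c.

Lemma pi_neq0 c : rf_lin c != 0.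
Proof. by rewrite /rf_lin /rf_X /rf_cst -rmorphB rf_inj_eq0 polyXsubC_eq0. Qed.
Lemma d_pi c : d (rf_lin c) = 1.
Proof. by rewrite dB dX d_cst subr0. Qed.
Lemma ev_pi c x : ev x (rf_lin c) (x - c).
Proof. by apply: evB; [apply: evX|apply: ev_cst]. Qed.
Lemma reg_pi c x : reg x (rf_lin c). Proof. by exists (x - c); apply: ev_pi. Qed.

Lemma ord_at c f : f != 0 -> exists (n : int) u, unitat c u /\ f = rf_lin c ^ n * u.
Proof.
move=> f0; have [p [q [q0 E]]] := rf_frac f.
have p0 : p != 0 by apply: contraNneq f0 => p0; rewrite E p0 rmorph0 mul0r.
have [m [p' pc pE]] := multiplicity_XsubC p c.
have [n [q' qc qE]] := multiplicity_XsubC q c.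
rewrite p0 /= in pc; rewrite q0 /= in qc.
exists (m%:Z - n%:Z), (j p' / j q'); split.
  exists (p'.[c] / q'.[c]); first by rewrite mulf_neq0 ?invr_eq0.
  by exists p', q'.
rewrite E pE qE !rmorphM !rmorphXn rmorphB -/(rf_lin c) expfzDr ?pi_neq0 // -exprnN.
rewrite -!exprnP; field.
by rewrite expf_neq0 ?pi_neq0 // (horner_neq0 qc).
Qed.

(* At a point where the residue of [om] is [rho], an element of order [n] other
   than [- rho] has a twisted derivative of order exactly [n - 1]. *)
Lemma ord_twisted_deriv c rho om0 g (e : int) h :
  reg c om0 -> reg c h ->
  d g + (rf_cst rho / rf_lin c + om0) * g = rf_lin c ^ e * h ->
  [\/ g = 0,
   exists n u, [/\ unitat c u, g = rf_lin c ^ n * u & n%:~R = - rho] |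
   exists n u, [/\ unitat c u, g = rf_lin c ^ n * u & e + 1 <= n]].
Proof.
move=> om0r hr; have [->|g0] := eqVneq g 0; first by constructor 1.
have [n [u [stage_coef gE]]] := ord_at c g0.
have [nr|nr] := eqVneq (n%:~R : F) (- rho); first by move=> _; constructor 2; exists n, u.
have [en|ne] := leP (e + 1) n; first by move=> _; constructor 3; exists n, u.
have u0 := unitat_neq0 stage_coef; have p0 := pi_neq0 c.
have pn0 (k : int) : rf_lin c ^ k != 0 by rewrite expfz_neq0.
rewrite -[d g](mulfVK g0) -mulrDl {2}gE {1 2}gE dlogM // dlogXz // d_pi => E.
(* After division by (x-c)^(n-1) u the left side takes the value n + rho at c, while the right side
   carries the positive exponent e + 1 - n and vanishes there. *)
have : n%:~R + rf_cst rho + rf_lin c * (d u / u + om0) = rf_lin c ^+ absz (e + 1 - n)%R * h / u.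
  have -> : rf_lin c ^+ absz (e + 1 - n)%R = rf_lin c ^ e * rf_lin c / rf_lin c ^ n.
    rewrite -[X in _ * X / _](expr1z (rf_lin c)) -expfzDr // invr_expz -expfzDr //.
    by rewrite exprnP gez0_abs // subr_ge0 ltW.
  apply: (mulfI (pn0 n)); apply: (mulIf u0); apply: (mulIf (invr_neq0 p0)).
  transitivity (rf_lin c ^ e * h); last by field; rewrite pn0 p0 u0.
  by rewrite -E; field; rewrite p0 u0.
move=> {}E; exfalso; move: nr; rewrite -addr_eq0 => /negP; apply.
apply/eqP; have [v [v0 vE]] : exists v, v != 0 /\ ev c u v by case: stage_coef => v; exists v.
have [w hw] := reg_d (unitat_reg stage_coef); have [z hz] := om0r; have [t ht] := hr.
have L : ev c (n%:~R + rf_cst rho + rf_lin c * (d u / u + om0))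
    (n%:~R + rho + (c - c) * (w / v + z)).
  apply: evD; last by apply: evM; [apply: ev_pi|apply: evD => //; apply: evM => //; apply: evV].
  apply: evD; last exact: ev_cst.
  have -> : n%:~R = rf_cst n%:~R by rewrite /rf_cst !rmorph_int.
  exact: ev_cst.
have R0 : ev c (rf_lin c ^+ absz (e + 1 - n)%R * h / u) ((c - c) ^+ absz (e + 1 - n)%R * t / v).
  by apply: evM; [apply: evM => //; apply: evXn; apply: ev_pi|apply: evV].
rewrite E in L; have := ev_uniq L R0; rewrite subrr mul0r addr0 => ->.
by rewrite expr0n absz_eq0 subr_eq0 gt_eqF // !mul0r.
Qed.

End LocalTheory.

(** * Darboux transformations *)

Section Darboux.
Variables (F : realFieldType) (K : ratfield F) (al be : F).
Local Notation j := (@rf_inj F K).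
Local Notation d := (@rf_d F K).
Local Notation cst := (@rf_cst F K).
Local Notation xx := (@rf_X F K).
Local Notation pi := (@rf_lin F K).

(* An element [y] with twist [f] stands for the function (1+x)^f y, whose
   derivative is (1+x)^f times [tderiv f y]; seeds in F1 have twist 0, seeds in F2
   twist -be.  [weighted_deriv g] is (w g)' / w for w = (1-x)^al (1+x)^be. *)
Definition one_minus_X2 : K := 1 - xx ^+ 2.
Definition inv_1pX : K := (pi (-1))^-1.
(** The first-order coefficient of the Jacobi operator with both parameters raised by m; each
    Darboux step, like each differentiation, raises both by one. *)
Definition tau_coef (m : nat) : K := cst (be - al) - cst (al + be + 2 + m%:R * 2) * xx.
Definition weight_dlog : K := cst al / pi 1 + cst be / pi (-1).
Definition tderiv (f : F) (y : K) : K := d y + cst f * inv_1pX * y.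
Definition weighted_deriv (g : K) : K := d g + weight_dlog * g.
Definition is_solution m (q : K) lam f y : Prop :=
  one_minus_X2 * tderiv f (tderiv f y) + tau_coef m * tderiv f y + (cst lam - q) * y = 0.

Lemma one_minus_X2E : one_minus_X2 = - (pi 1 * pi (-1)).
Proof. by rewrite /one_minus_X2 /rf_lin cstN cst1; ring. Qed.

Lemma d_one_minus_X2 : d one_minus_X2 = - (2 * xx).
Proof. by rewrite /one_minus_X2 dB d1 expr2 rf_dM dX; ring. Qed.

Lemma tderivD f x y : tderiv f (x + y) = tderiv f x + tderiv f y.
Proof. by rewrite /tderiv rf_dD; ring. Qed.
Lemma tderivB f x y : tderiv f (x - y) = tderiv f x - tderiv f y.
Proof. by rewrite /tderiv dB; ring. Qed.
Lemma tderivM f x y : tderiv f (x * y) = d x * y + x * tderiv f y.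
Proof. by rewrite /tderiv rf_dM; ring. Qed.
Lemma tderiv_scale f c y : tderiv f (cst c * y) = cst c * tderiv f y.
Proof. by rewrite tderivM d_cst mul0r add0r. Qed.
Lemma tderiv_twist0 y : tderiv 0 y = d y.
Proof. by rewrite /tderiv cst0 !mul0r addr0. Qed.
Lemma tderiv0 f : tderiv f 0 = 0.
Proof. by rewrite /tderiv d0 mulr0 addr0. Qed.

Lemma d_tau_coef m : d (tau_coef m) = - cst (al + be + 2 + m%:R * 2).
Proof. by rewrite /tau_coef dB d_cst rf_dM d_cst dX; ring. Qed.

Lemma tau_coefS m : tau_coef m.+1 = tau_coef m + d one_minus_X2.
Proof. by rewrite d_one_minus_X2 /tau_coef -[m.+1]addn1 natrD !(cstD, cstM, cst_nat); ring. Qed.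

(** Pearson's equation: [tau_coef m] times (1-x^2)^m w is the derivative of (1-x^2)^(m+1) w. It puts
    the operator of stage m into self-adjoint form. *)
Lemma tau_coef_weight m : tau_coef m = m.+1%:R * d one_minus_X2 + one_minus_X2 * weight_dlog.
Proof.
rewrite d_one_minus_X2 one_minus_X2E /weight_dlog /tau_coef -[m.+1]addn1 natrD !(cstB, cstD, cstM, cst_nat).
have := pi_neq0 K 1; have := pi_neq0 K (-1).
rewrite /rf_lin cstN cst1 => h1 h2; field.
by move: h1 h2; rewrite opprK => h1 h2; apply/andP.
Qed.

(* Subtracting the equations of the seed and of [y] eliminates the potential [q]. *)
Lemma darboux_star m q mu e p lam f y :
  is_solution m q mu e p -> p != 0 -> is_solution m q lam f y ->
  let v := tderiv e p / p in let y1 := tderiv f y - v * y in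
  one_minus_X2 * (tderiv f y1 + v * y1) + tau_coef m * y1 + (cst lam - cst mu) * y = 0.
Proof.
move=> Sp p0 Sy v y1.
have dv : d v = tderiv e (tderiv e p) / p - v ^+ 2.
  have : tderiv e (v * p) = d v * p + v * tderiv e p by rewrite tderivM.
  rewrite /v mulfVK // => ->; field; exact: p0.
rewrite /y1 tderivB tderivM dv; move: Sp Sy; rewrite /is_solution => Sp Sy.
transitivity (one_minus_X2 * tderiv f (tderiv f y) + tau_coef m * tderiv f y + (cst lam - q) * y
  - y / p * (one_minus_X2 * tderiv e (tderiv e p) + tau_coef m * tderiv e p + (cst mu - q) * p)).
  by rewrite /v; field.
by rewrite Sp Sy mulr0 subr0.
Qed.

Definition new_potential m mu v : K :=
  cst mu - d (one_minus_X2 * v) - d (tau_coef m) + one_minus_X2 * v ^+ 2 + tau_coef m * v.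

(** Differentiate the first-order relation and subtract v times it: y survives only in (lam - mu)
    (y' - v y) = (lam - mu) y1. The coefficients left over on y1 define [new_potential]. *)
Lemma darboux_solution m mu lam f y v :
  let y1 := tderiv f y - v * y in
  one_minus_X2 * (tderiv f y1 + v * y1) + tau_coef m * y1 + (cst lam - cst mu) * y = 0 ->
  is_solution m.+1 (new_potential m mu v) lam f y1.
Proof.
move=> y1 S; have y1E : tderiv f y = y1 + v * y by rewrite /y1 subrK.
clearbody y1; have := congr1 (tderiv f) S; rewrite tderiv0.
rewrite !tderivD !(tderivM f _ y1) -cstB tderiv_scale (tderivM f one_minus_X2) tderivD (tderivM f v) cstB => S'.
rewrite /is_solution /new_potential tau_coefS rf_dM.
transitivity ((d one_minus_X2 * (tderiv f y1 + v * y1) + one_minus_X2 * (tderiv f (tderiv f y1) + (d v * y1 + v * tderiv f y1))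
   + (d (tau_coef m) * y1 + tau_coef m * tderiv f y1) + (cst lam - cst mu) * tderiv f y)
  - v * (one_minus_X2 * (tderiv f y1 + v * y1) + tau_coef m * y1 + (cst lam - cst mu) * y)).
  by rewrite y1E; move: (tderiv f (tderiv f y1)) (tderiv f y1) (d v) (d one_minus_X2) (d (tau_coef m)) (tau_coef m) one_minus_X2 => *; ring.
by rewrite S S' mulr0 subr0.
Qed.

(* One integration by parts of the Darboux norm identity, before integrating. *)
Lemma darboux_norm m c y v :
  let y1 := d y - v * y in
  one_minus_X2 * (d y1 + v * y1) + tau_coef m * y1 + c * y = 0 ->
  one_minus_X2 ^+ m.+1 * y1 ^+ 2 = c * one_minus_X2 ^+ m * y ^+ 2 + weighted_deriv (one_minus_X2 ^+ m.+1 * (y * y1)).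
Proof.
move=> y1 S; have dy : d y = y1 + v * y by rewrite /y1 subrK.
clearbody y1.
apply/eqP; rewrite -subr_eq0; apply/eqP.
transitivity (- (one_minus_X2 ^+ m * y * (one_minus_X2 * (d y1 + v * y1) + tau_coef m * y1 + c * y))); last first.
  by rewrite S mulr0 oppr0.
rewrite tau_coef_weight /weighted_deriv rf_dM dXn rf_dM dy exprS.
by move: (d y1) (d one_minus_X2) one_minus_X2 weight_dlog m.+1%:R (one_minus_X2 ^+ m) => *; ring.
Qed.

Variables (mu e : nat -> F) (a : nat -> K).

(* [dstage m f y] is the image of [y] after the Darboux steps along the seeds
   0, ..., m-1, each of them transformed by the previous steps. *)
Fixpoint dstage (m : nat) (f : F) (y : K) {struct m} : K :=
  if m is m'.+1 then
    let p := dstage m' (e m') (a m') in tderiv f (dstage m' f y) - tderiv (e m') p / p * dstage m' f y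
  else y.

Definition dseed m := dstage m (e m) (a m).
Definition dlog_seed m := tderiv (e m) (dseed m) / dseed m.

Lemma dstageS m f y : dstage m.+1 f y = tderiv f (dstage m f y) - dlog_seed m * dstage m f y.
Proof. by []. Qed.

Fixpoint dpotential (m : nat) : K :=
  if m is m'.+1 then new_potential m' (mu m') (dlog_seed m') else 0.

Lemma dstage_solution k m lam f y :
  (forall i, (i < k)%N -> is_solution 0 0 (mu i) (e i) (a i)) ->
  (m <= k)%N -> (forall i, (i < m)%N -> dseed i != 0) ->
  is_solution 0 0 lam f y -> is_solution m (dpotential m) lam f (dstage m f y).
Proof.
move=> Sa; elim: m lam f y => [|m IH] lam f y mk p0 Sy //.
have p0' i : (i < m)%N -> dseed i != 0 by move=> im; apply: p0; rewrite ltnW.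
apply: darboux_solution; apply: darboux_star (IH _ _ _ _ _ (Sa _ mk)) _ _ => //; first exact: ltnW.
  by apply: p0.
by apply: IH => //; apply: ltnW.
Qed.

Lemma dstage_star k m lam f y :
  (forall i, (i < k)%N -> is_solution 0 0 (mu i) (e i) (a i)) ->
  (m < k)%N -> (forall i, (i <= m)%N -> dseed i != 0) ->
  is_solution 0 0 lam f y ->
  one_minus_X2 * (tderiv f (dstage m.+1 f y) + dlog_seed m * dstage m.+1 f y) + tau_coef m * dstage m.+1 f y
    + (cst lam - cst (mu m)) * dstage m f y = 0.
Proof.
move=> Sa mk p0 Sy; have p0' i : (i < m)%N -> dseed i != 0 by move=> /ltnW; apply: p0.
apply: darboux_star (dstage_solution Sa (ltnW mk) p0' (Sa _ mk)) _ (dstage_solution Sa (ltnW mk) p0' Sy).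
exact: p0.
Qed.

(** The function g of the norm identity: each integration by parts multiplies the earlier boundary
    terms by its eigenvalue difference and adds one of its own. *)
Fixpoint boundary_sum lam (y : K) (m : nat) : K :=
  if m is m'.+1 then cst (lam - mu m') * boundary_sum lam y m' + one_minus_X2 ^+ m * (dstage m' 0 y * dstage m 0 y) else 0.

Lemma boundary_sumS lam y m : boundary_sum lam y m.+1 =
  cst (lam - mu m) * boundary_sum lam y m + one_minus_X2 ^+ m.+1 * (dstage m 0 y * dstage m.+1 0 y).
Proof. by []. Qed.

Lemma weighted_derivD x y : weighted_deriv (x + y) = weighted_deriv x + weighted_deriv y.
Proof. by rewrite /weighted_deriv rf_dD; ring. Qed.
Lemma weighted_deriv_scale c x : weighted_deriv (cst c * x) = cst c * weighted_deriv x.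
Proof. by rewrite /weighted_deriv rf_dM d_cst; ring. Qed.
Lemma weighted_deriv0 : weighted_deriv 0 = 0. Proof. by rewrite /weighted_deriv d0; ring. Qed.

Lemma dstage_norm k m lam y :
  (forall i, (i < k)%N -> is_solution 0 0 (mu i) (e i) (a i)) ->
  (m <= k)%N -> (forall i, (i < m)%N -> dseed i != 0) ->
  is_solution 0 0 lam 0 y ->
  one_minus_X2 ^+ m * dstage m 0 y ^+ 2 =
    cst (\prod_(i < m) (lam - mu i)) * y ^+ 2 + weighted_deriv (boundary_sum lam y m).
Proof.
move=> Sa; elim: m => [|m IH] mk p0 Sy.
  by rewrite big_ord0 cst1 /= weighted_deriv0 expr0; ring.
have := dstage_star Sa mk p0 Sy; rewrite tderiv_twist0 -cstB.
have stE : dstage m.+1 0 y = d (dstage m 0 y) - dlog_seed m * dstage m 0 y by rewrite dstageS tderiv_twist0.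
have := @darboux_norm m (cst (lam - mu m)) (dstage m 0 y) (dlog_seed m); rewrite /= -stE => N /N ->.
rewrite -mulrA IH ?(ltnW mk) //; last by move=> i im; apply: p0; rewrite ltnW.
rewrite big_ord_recr /= weighted_derivD weighted_deriv_scale cstM; ring.
Qed.

End Darboux.

(** * Orders of the transformed seeds at the endpoints *)

Section DarbouxLocal.
Variables (F : realFieldType) (K : ratfield F) (al be : F).
Local Notation j := (@rf_inj F K).
Local Notation d := (@rf_d F K).
Local Notation cst := (@rf_cst F K).
Local Notation xx := (@rf_X F K).
Local Notation pi := (@rf_lin F K).
Local Notation del := (@tderiv F K).
Local Notation sK := (@one_minus_X2 F K).
Local Notation kap := (@inv_1pX F K).
Local Notation tauK := (@tau_coef F K al be).
Local Notation Sol := (@is_solution F K al be).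

Lemma reg_tau_coef c m : reg c (tauK m).
Proof. by apply: regB; [|apply: regM]; do ?[apply: reg_cst|apply: reg_X]. Qed.
Lemma ev_one_minus_X2 c : ev c sK (1 - c ^+ 2).
Proof. by apply: evB; [apply: ev1|apply: evXn; apply: evX]. Qed.
Lemma unit_pi c x : x != c -> unitat x (pi c).
Proof. by move=> xc; exists (x - c); [rewrite subr_eq0|apply: ev_pi]. Qed.
Lemma reg_inv_1pX c : c != -1 -> reg c kap.
Proof. by move=> c1; apply: regV; apply: unit_pi. Qed.
Lemma reg_tderiv c f y : c != -1 -> reg c y -> reg c (del f y).
Proof.
move=> c1 ry; apply: regD; first exact: reg_d.
by apply: regM => //; apply: regM; [apply: reg_cst|apply: reg_inv_1pX].
Qed.

(* At c = 1 and c = -1 the leading coefficient 1-x^2 vanishes, so the equation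
   determines the value of the transformed function from that of [y]. *)
Lemma star_unit (c : F) lam mu T (y y1 Z : K) :
  1 - c ^+ 2 = 0 -> reg c Z -> reg c T -> lam != mu ->
  sK * Z + T * y1 + (cst lam - cst mu) * y = 0 ->
  unitat c y -> reg c y1 -> unitat c y1.
Proof.
move=> c1 [z hz] [t ht] lm E [v v0 hv] [w hw]; exists w => //.
apply/eqP => w0; rewrite w0 in hw.
have := evD (evD (evM (ev_one_minus_X2 c) hz) (evM ht hw)) (evM (evB (ev_cst K c lam) (ev_cst K c mu)) hv).
rewrite E => /(ev_uniq (ev0 K c))/eqP.
by rewrite c1 mul0r mulr0 !add0r eq_sym mulf_eq0 subr_eq0 (negPf lm) (negPf v0).
Qed.

Variables (mu e : nat -> F) (a : nat -> K) (k : nat).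
Local Notation st := (@dstage F K e a).
Local Notation psi := (@dseed F K e a).
Local Notation vv := (@dlog_seed F K e a).
Hypothesis SolA : forall i, (i < k)%N -> Sol 0 0 (mu i) (e i) (a i).
Hypothesis mu_neq : forall i l, (i < l)%N -> (l < k)%N -> mu l != mu i.
Hypothesis unit1 : forall i, (i < k)%N -> unitat 1 (a i).

Lemma chain_at1 m : (m <= k)%N ->
  [/\ forall i, (i < m)%N -> psi i != 0,
      forall i, (m <= i < k)%N -> unitat 1 (st m (e i) (a i)) &
      forall f y, reg 1 y -> reg 1 (st m f y)].
Proof.
have n1 : (1 : F) != -1 by rewrite -subr_eq0 opprK gt_eqF // addr_gt0.
elim: m => [|m IH] mk; first by split=> // i; exact: unit1.
have [pn um rm] := IH (ltnW mk).
have um0 : unitat 1 (psi m) by apply: um; rewrite leqnn.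
have pn' i : (i <= m)%N -> psi i != 0.
  by rewrite leq_eqVlt => /orP[/eqP ->|/pn //]; apply: unitat_neq0 um0.
have rv : reg 1 (vv m).
  by apply: regM; [exact: reg_tderiv (n1) (unitat_reg um0)|apply: regV].
have rS f y : reg 1 y -> reg 1 (st m.+1 f y).
  by move=> /(rm f) ry; rewrite dstageS; apply: regB; [exact: reg_tderiv (n1) ry|apply: regM].
split=> // i /andP[mi ik].
have rSi : reg 1 (st m.+1 (e i) (a i)) by apply: rS; apply: unitat_reg; apply: unit1.
have S := dstage_star SolA mk pn' (SolA ik).
apply: star_unit (S) _ (rSi); rewrite ?expr1n ?subrr ?mu_neq //.
- by apply: regD; [exact: reg_tderiv (n1) rSi|apply: regM].
- exact: reg_tau_coef.
by apply: um; rewrite ik ltnW.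
Qed.

Lemma dseed_neq0 i : (i < k)%N -> psi i != 0.
Proof. by have [h _ _] := chain_at1 (leqnn k); exact: h. Qed.

Lemma reg1_dstage m f y : (m <= k)%N -> reg 1 y -> reg 1 (st m f y).
Proof. by move=> mk; have [_ _] := chain_at1 mk; exact. Qed.

Variables (k1 k2 : nat).
Hypothesis kE : k = (k1 + k2)%N.
Hypothesis e1 : forall i, (i < k1)%N -> e i = 0.
Hypothesis e2 : forall i, (k1 <= i < k)%N -> e i = - be.
Hypothesis unitN1 : forall i, (i < k)%N -> unitat (-1) (a i).
Hypothesis be_neq : forall m, (m < k1)%N -> (0 < k2)%N -> be + m%:R != 0.
Local Notation p := (pi (-1)).

Let p0 : p != 0. Proof. exact: pi_neq0. Qed.

(** Absorbing (1+x)^n into the function lowers the twist from f to f - n; one further factor 1+x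
    clears the pole of the twisted derivation. *)
Lemma tderiv_linX n f y : p ^+ n.+1 * del f y =
  p * d (p ^+ n * y) + cst (f - n%:R) * (p ^+ n * y).
Proof.
rewrite /tderiv /inv_1pX rf_dM mulrDr cstB cst_nat.
case: n => [|n]; first by rewrite expr0 d1; field.
by rewrite dXn d_pi (exprS p n.+1) !(exprS p n); field.
Qed.

Lemma reg_tderiv_linX n f y : reg (-1) (p ^+ n * y) -> reg (-1) (p ^+ n.+1 * del f y).
Proof.
move=> ry; rewrite tderiv_linX; apply: regD; last by apply: regM => //; apply: reg_cst.
by apply: regM; [apply: reg_pi|apply: reg_d].
Qed.

(* Each seed of F1 lowers by one the exponent at -1 of the seeds of F2, which is
   -be at the start. *)
Lemma phase1_atN1 m : (m <= k1)%N ->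
  [/\ forall i, (m <= i < k1)%N -> unitat (-1) (st m (e i) (a i)),
      forall y, reg (-1) y -> reg (-1) (st m 0 y) &
      forall i, (k1 <= i < k)%N -> unitat (-1) (p ^+ m * st m (e i) (a i))].
Proof.
elim: m => [|m IH] mk.
  split=> // i /andP[i0 ik]; last by rewrite expr0 mul1r; apply: unitN1.
  by apply: unitN1; rewrite kE ltn_addr.
have [u1 rm u2] := IH (ltnW mk).
have kk : (k1 <= k)%N by rewrite kE leq_addr.
have mk' : (m < k)%N by apply: leq_trans mk kk.
have um0 : unitat (-1) (psi m) by apply: u1; rewrite leqnn.
have rv : reg (-1) (vv m).
  apply: regM; last exact: regV.
  by rewrite e1 // tderiv_twist0; apply: reg_d; apply: unitat_reg.
have rS y : reg (-1) y -> reg (-1) (st m.+1 0 y).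
  by move=> /rm ry; rewrite dstageS tderiv_twist0; apply: regB; [apply: reg_d|apply: regM].
split=> // i /andP[mi ik].
  have rSi : reg (-1) (st m.+1 (e i) (a i)).
    by rewrite e1 //; apply: rS; apply: unitat_reg; apply: unitN1; apply: leq_trans ik kk.
  have ik' : (i < k)%N by apply: leq_trans kk.
  have S := dstage_star SolA mk' (fun l lm => dseed_neq0 (leq_ltn_trans lm mk')) (SolA ik').
  apply: star_unit (S) _ (rSi); rewrite ?sqrrN ?expr1n ?subrr ?mu_neq //.
  - by rewrite e1 // tderiv_twist0 in rSi *; apply: regD; [apply: reg_d|apply: regM].
  - exact: reg_tau_coef.
  by apply: u1; rewrite ik ltnW.
have : unitat (-1) (p ^+ m * st m (e i) (a i)) by apply: u2; rewrite mi ik.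
rewrite dstageS mulrBr tderiv_linX e2 ?mi //; set b := _ * st m _ _ => ub.
have [v v0 hv] := ub; have [w hw] := reg_d (unitat_reg ub); have [z hz] := rv.
(* The terms with a factor 1+x vanish at -1. What remains is (-be - m) v, nonzero by [be_neq]. *)
exists ((-1 - -1) * w + (- be - m%:R) * v - ((-1 - -1) * z * v)).
  rewrite subrr !mul0r add0r subr0 mulf_neq0 // -opprD oppr_eq0 be_neq //.
  by rewrite -(ltn_add2l k1) addn0 -kE; apply: leq_ltn_trans mi ik.
apply: evB; first by apply: evD; apply: evM => //; [apply: ev_pi|apply: ev_cst].
rewrite [X in ev _ X](_ : _ = p * vv m * b); last by rewrite /b exprS; ring.
by apply: evM => //; apply: evM => //; apply: ev_pi.
Qed.

(** The function behind [psi m] is (1+x)^(-be-k1) chi, and its logarithmic derivative splits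
    accordingly into a part from chi and a simple pole. *)
Lemma dlog_seedE m : (k1 <= m < k)%N ->
  let chi := p ^+ k1 * psi m in
  chi != 0 -> vv m = d chi / chi + cst (- be - k1%:R) / p.
Proof.
move=> mk chi chi0; rewrite /dlog_seed e2 //.
have := tderiv_linX k1 (- be) (psi m); rewrite -/chi => E.
have pk0 : p ^+ k1 != 0 by rewrite expf_neq0.
have psE : psi m = chi / p ^+ k1 by rewrite /chi mulrC mulKf.
have -> : del (- be) (psi m) = (p * d chi + cst (- be - k1%:R) * chi) / p ^+ k1.+1.
  by rewrite -E mulrC mulKf // expf_neq0.
by rewrite psE exprS; field; rewrite p0 chi0 pk0.
Qed.

(* Each seed of F2 adds at most a simple pole at -1 to the untwisted functions. *)
Lemma phase2_atN1 i : (i <= k2)%N ->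
  (forall l, (k1 + i <= l < k)%N -> unitat (-1) (p ^+ k1 * st (k1 + i) (e l) (a l))) /\
  (forall y, reg (-1) y -> reg (-1) (p ^+ i * st (k1 + i) 0 y)).
Proof.
elim: i => [|i IH] ik.
  rewrite addn0; have [_ r u] := phase1_atN1 (leqnn k1); split=> // y /r.
  by rewrite expr0 mul1r.
have [u r] := IH (ltnW ik); set m := (k1 + i)%N in u r *.
have mk : (m < k)%N by rewrite kE ltn_add2l.
have k1m : (k1 <= m)%N by rewrite leq_addr.
have uchi : unitat (-1) (p ^+ k1 * psi m) by apply: u; rewrite leqnn.
have chi0 := unitat_neq0 uchi.
have vE := dlog_seedE (introT andP (conj k1m mk)) chi0.
move: vE; rewrite /=; set chi := p ^+ k1 * psi m in uchi chi0 * => vE.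
have rl : reg (-1) (d chi / chi) by apply: regM; [apply: reg_d; apply: unitat_reg|apply: regV].
have rpv : reg (-1) (p * vv m).
  rewrite vE mulrDr; apply: regD; first by apply: regM => //; apply: reg_pi.
  by rewrite mulrC mulfVK //; apply: reg_cst.
rewrite addnS; split; last first.
  move=> y /r; rewrite dstageS mulrBr => ry; apply: regB; first exact: reg_tderiv_linX.
  rewrite [X in reg _ X](_ : _ = p * vv m * (p ^+ i * st m 0 y)); last by rewrite exprS; ring.
  exact: regM.
move=> l /andP[ml lk].
have el : e l = - be by apply: e2; rewrite lk andbT (leq_trans k1m) // ltnW.
have ul := u l (introT andP (conj (ltnW ml) lk)).
(* After the first phase all seeds of F2 share the exponent -be - k1 at -1, so the poles of the
   twist and of [vv m] cancel and the exponent stays fixed from now on. *)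
have b1E : p ^+ k1 * st m.+1 (e l) (a l) =
    d (p ^+ k1 * st m (e l) (a l)) - d chi / chi * (p ^+ k1 * st m (e l) (a l)).
  apply: (mulfI p0); rewrite [LHS]mulrA -exprS dstageS mulrBr tderiv_linX vE el exprS.
  by move: (st m _ _) (d chi / chi) (d _) => *; field.
have rb1 : reg (-1) (p ^+ k1 * st m.+1 (e l) (a l)).
  rewrite b1E; apply: regB; first by apply: reg_d; apply: unitat_reg.
  by apply: regM => //; apply: unitat_reg.
have S := dstage_star SolA mk (fun l lm => dseed_neq0 (leq_ltn_trans lm mk)) (SolA lk).
(* Here the twist and [vv m] add up: two simple poles of residue -be - k1, which 1-x^2 cancels. They
   leave the extra term in the first-order coefficient. *)
have S' : sK * (d (p ^+ k1 * st m.+1 (e l) (a l)) + d chi / chi * (p ^+ k1 * st m.+1 (e l) (a l)))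
   + (tauK m - 2 * cst (- be - k1%:R) * pi 1) * (p ^+ k1 * st m.+1 (e l) (a l))
   + (cst (mu l) - cst (mu m)) * (p ^+ k1 * st m (e l) (a l)) = 0.
  apply: (mulfI p0); rewrite mulr0.
  have := congr1 ( *%R (p ^+ k1.+1)) S; rewrite mulr0 => S'.
  rewrite -[RHS]S'; have := tderiv_linX k1 (e l) (st m.+1 (e l) (a l)).
  rewrite vE el; set dd := del _ _ => ddE.
  rewrite [RHS](_ : _ = sK * (p ^+ k1.+1 * dd + p ^+ k1.+1 * ((d chi / chi + cst (- be - k1%:R) / p)
     * st m.+1 (- be) (a l))) + p ^+ k1.+1 * (tauK m * st m.+1 (- be) (a l) +
     (cst (mu l) - cst (mu m)) * st m (- be) (a l))); last by ring.
  rewrite ddE one_minus_X2E exprS; move: (d chi / chi) (d _) (st _ _ _) (st _ _ _) (tauK m) => *.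
  by field; apply/andP.
apply: star_unit (S') (ul) (rb1); rewrite ?sqrrN ?expr1n ?subrr ?mu_neq //.
  by apply: regD; [apply: reg_d|apply: regM].
apply: regB; first exact: reg_tau_coef.
by apply: regM; [apply: regM; [apply: reg_nat|apply: reg_cst]|apply: reg_pi].
Qed.

(** At -1 a transformed seed of F1 has order 0 and one of F2 has order exactly -k1. *)
Lemma prod_dseed_atN1 n : (n <= k)%N -> (k1 <= n)%N ->
  unitat (-1) (p ^+ (k1 * (n - k1)) * \prod_(i < n) psi i).
Proof.
elim: n => [|n IH].
  rewrite leqn0 => _ /eqP ->; rewrite big_ord0 mulr1 expr0; exact: unitat1.
move=> nk; rewrite leq_eqVlt => /orP[/eqP k1E|k1n].
  rewrite k1E subnn muln0 expr0 mul1r.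
  apply: (big_ind (unitat (-1))); [exact: unitat1|exact: unitatM|move=> i _].
  have ik : (i < k1)%N by rewrite k1E.
  by have [h _ _] := phase1_atN1 (ltnW ik); apply: h; rewrite leqnn.
rewrite big_ord_recr /= subSn // mulnS exprD.
set P := \prod_(_ < _) _; set q := p ^+ (k1 * _).
rewrite [X in unitat _ X](_ : _ = (q * P) * (p ^+ k1 * psi n)); last by ring.
apply: unitatM; first exact: (IH (ltnW nk)).
have ni : (n - k1 <= k2)%N by rewrite leq_subLR -kE ltnW.
have [h _] := phase2_atN1 ni; rewrite subnKC // in h.
by apply: h; rewrite leqnn nk.
Qed.

End DarbouxLocal.

(** * The Wronskian as the product of the transformed seeds *)

Section ChainDeterminant.
Variables (F : realFieldType) (K : ratfield F).
Local Notation d := (@rf_d F K).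
Local Notation del := (@tderiv F K).
Variables (e : nat -> F) (a : nat -> K).
Local Notation st := (@dstage F K e a).
Local Notation psi := (@dseed F K e a).
Local Notation vv := (@dlog_seed F K e a).

(** Coefficients of the monic operator [dstage m] in the iterates of the twisted derivation. They
    depend neither on the twist nor on the function, so the same column operations serve the rows of
    both kinds. *)
Fixpoint stage_coef (m l : nat) : K :=
  if m is m'.+1 then d (stage_coef m' l) + (if l is l'.+1 then stage_coef m' l' else 0) - vv m' * stage_coef m' l
  else (l == 0%N)%:R.

Lemma stage_coef_gt m l : (m < l)%N -> stage_coef m l = 0.
Proof.
elim: m l => [|m IH] [|l] //= ml.
by rewrite !IH // ?d0 ?mulr0 ?subrr ?addr0 ?subr0 // ltnW.
Qed.

Lemma stage_coef_diag m : stage_coef m m = 1.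
Proof. by elim: m => [|m IH] //=; rewrite IH stage_coef_gt // d0 mulr0 add0r subr0. Qed.

Lemma tderiv_sum f n (G : 'I_n -> K) : del f (\sum_(l < n) G l) = \sum_(l < n) del f (G l).
Proof. by apply: (big_morph (del f)); [exact: tderivD|exact: tderiv0]. Qed.

Lemma dstage_expand n m f y : (m < n)%N ->
  st m f y = \sum_(l < n) stage_coef m l * iter l (del f) y.
Proof.
elim: m n => [|m IH] [|n] // mn.
  by rewrite big_ord_recl /= ?eqxx ?mulr1n mul1r big1 ?addr0 // => i _; rewrite mul0r.
have -> : st m.+1 f y = del f (st m f y) - vv m * st m f y by [].
have -> : del f (st m f y) = \sum_(l < n) del f (stage_coef m l * iter l (del f) y).
  by rewrite (IH n) // tderiv_sum.
rewrite (IH n.+1); last exact: ltnW.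
rewrite mulr_sumr.
transitivity (\sum_(l < n.+1) d (stage_coef m l) * iter l (del f) y +
   \sum_(l < n.+1) (if (l : nat) is l'.+1 then stage_coef m l' else 0) * iter l (del f) y
   - \sum_(l < n.+1) vv m * (stage_coef m l * iter l (del f) y)).
  congr (_ - _); rewrite [X in _ = X + _]big_ord_recr /= stage_coef_gt // d0 mul0r addr0.
  rewrite [X in _ = _ + X]big_ord_recl /= mul0r add0r -big_split /=.
  by apply: eq_bigr => i _; rewrite tderivM.
rewrite -big_split -sumrB /=; apply: eq_bigr => i _.
by rewrite mulrBl mulrDl mulrA.
Qed.

Lemma dstage_self_next i : psi i != 0 -> st i.+1 (e i) (a i) = 0.
Proof. by move=> p0; rewrite dstageS /dlog_seed -/(psi i) mulfVK // subrr. Qed.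

Lemma dstage_self_gt i m : psi i != 0 -> (i < m)%N -> st m (e i) (a i) = 0.
Proof.
move=> p0; elim: m => // m IH; rewrite ltnS leq_eqVlt => /orP[/eqP <-|im].
  exact: dstage_self_next.
by rewrite dstageS IH // tderiv0 mulr0 subr0.
Qed.

(* The monic operators [dstage m] differ from the iterates of [tderiv] by a unitriangular
   change of columns, after which the Wronskian matrix is lower triangular. *)
Lemma det_chain n : (forall i, (i.+1 < n)%N -> psi i != 0) ->
  \det (\matrix_(i < n, l < n) iter l (del (e i)) (a i)) = \prod_(i < n) psi i.
Proof.
move=> p0; set M := \matrix_(_, _) _.
pose U : 'M[K]_n := \matrix_(l < n, m < n) stage_coef m l.
have dU : \det U = 1.
  rewrite -det_tr det_trig; last first.
    by apply/is_trig_mxP => i l il; rewrite !mxE stage_coef_gt.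
  by apply: big1 => i _; rewrite !mxE stage_coef_diag.
have MU : M *m U = \matrix_(i < n, m < n) st m (e i) (a i).
  apply/matrixP => i m; rewrite !mxE (dstage_expand _ _ (ltn_ord m)).
  by apply: eq_bigr => l _; rewrite !mxE mulrC.
rewrite -[LHS]mulr1 -[X in _ * X]dU -det_mulmx MU det_trig.
  by apply: eq_bigr => i _; rewrite mxE.
apply/is_trig_mxP => i l il; rewrite mxE dstage_self_gt // p0 //.
exact: leq_ltn_trans il (ltn_ord l).
Qed.

End ChainDeterminant.

(** * Regularity of the transformed function and of the boundary terms *)

Section RegularChain.
Variables (F : realFieldType) (K : ratfield F) (al be : F).
Local Notation j := (@rf_inj F K).
Local Notation d := (@rf_d F K).
Local Notation cst := (@rf_cst F K).
Local Notation pi := (@rf_lin F K).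
Local Notation del := (@tderiv F K).
Local Notation sK := (@one_minus_X2 F K).
Variables (mu e : nat -> F) (a : nat -> K) (k : nat).
Local Notation st := (@dstage F K e a).
Local Notation psi := (@dseed F K e a).

Lemma dstage_ext (e' : nat -> F) (a' : nat -> K) m f y :
  (forall i, (i < m)%N -> e' i = e i /\ a' i = a i) ->
  dstage e' a' m f y = st m f y.
Proof.
elim: m f y => // m IH f y H; rewrite !dstageS /dlog_seed /dseed.
have H' i : (i < m)%N -> e' i = e i /\ a' i = a i by move=> im; apply: H; rewrite ltnW.
by rewrite !IH //; case: (H m (leqnn _)) => -> ->.
Qed.

Lemma reg_prod c n (G : 'I_n -> K) : (forall i, reg c (G i)) -> reg c (\prod_(i < n) G i).
Proof. by move=> h; apply: (big_ind (reg c)) => //; [exact: reg1|exact: regM]. Qed.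
Lemma reg_det c n (M : 'M[K]_n) : (forall i l, reg c (M i l)) -> reg c (\det M).
Proof.
move=> h; rewrite /determinant; apply: (big_ind (reg c)); [exact: reg0|exact: regD|move=> s _].
apply: regM; last exact: reg_prod.
by apply: regXn; apply: regN; apply: reg1.
Qed.

Lemma reg_iter_tderiv c l f y : c != -1 -> reg c y -> reg c (iter l (del f) y).
Proof. by move=> c1 ry; elim: l => //= l; apply: reg_tderiv. Qed.

Hypothesis psi0 : forall i, (i < k)%N -> psi i != 0.

(** With y appended as seed number k, of twist 0, [det_chain] makes y_k times the product of the
    seeds a determinant with regular entries. Hence y_k is regular wherever the full product is a
    unit, whatever the poles of the intermediate stages. *)
Lemma reg_dstage_inside c y : c != -1 -> (forall i, (i < k)%N -> reg c (a i)) -> reg c y ->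
  unitat c (\prod_(i < k) psi i) -> reg c (st k 0 y).
Proof.
move=> c1 ra ry uW.
pose e' i := if (i < k)%N then e i else 0.
pose a' i := if (i < k)%N then a i else y.
have E m f z : (m <= k)%N -> dstage e' a' m f z = st m f z.
  by move=> mk; apply: dstage_ext => i im; rewrite /e' /a' (leq_trans im mk).
have psE i : (i < k)%N -> dseed e' a' i = psi i.
  by move=> ik; rewrite /dseed E ?(ltnW ik) // /e' /a' ik.
have pk : dseed e' a' k = st k 0 y by rewrite /dseed E // /e' /a' ltnn.
have := @det_chain F K e' a' k.+1; rewrite big_ord_recr /= pk => D.
have -> : st k 0 y = (\prod_(i < k) psi i)^-1 * ((\prod_(i < k) psi i) * st k 0 y).
  by rewrite mulKf // (unitat_neq0 uW).
apply: regM; first exact: regV.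
rewrite -(eq_bigr _ (fun (i : 'I_k) _ => psE i (ltn_ord i))) -D; last first.
  by move=> i ik; rewrite psE // psi0.
apply: reg_det => i l; rewrite mxE; apply: reg_iter_tderiv => //.
by rewrite /a'; case: ifP => // ik; apply: ra.
Qed.

Lemma one_minus_X2_exp m : sK ^+ m.+1 = pi 1 * (- pi (-1) * sK ^+ m).
Proof. by rewrite exprS {1}one_minus_X2E; ring. Qed.

Lemma reg_one_minus_X2 c : reg c sK.
Proof. by exists (1 - c ^+ 2); apply: ev_one_minus_X2. Qed.

Lemma boundary_sum_at1 lam y m : (forall i, (i <= m)%N -> reg 1 (st i 0 y)) ->
  reg 1 ((pi 1)^-1 * boundary_sum mu e a lam y m).
Proof.
elim: m => [|m IH] ry; first by rewrite mulr0; apply: reg0.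
rewrite boundary_sumS mulrDr; apply: regD.
  rewrite mulrCA; apply: regM; first exact: reg_cst.
  by apply: IH => i im; apply: ry; apply: leq_trans im _.
rewrite one_minus_X2_exp -!mulrA mulKf ?pi_neq0 //; apply: regM; first by apply: regN; apply: reg_pi.
apply: regM; first by apply: regXn; apply: reg_one_minus_X2.
by apply: regM; [exact: ry|exact: (ry m.+1 (leqnn _))].
Qed.

(** [E0] bounds the order at -1 from below. A term of the first phase has order at least 1; the term
    joining stages k1+i and k1+i+1 has order at least (k1+i+1) - i - (i+1) = k1 - i, with i < k2. *)
Lemma boundary_sum_atN1 lam y k1 k2 (E0 : int) m : E0 <= 1 -> E0 <= k1%:Z - k2%:Z + 1 ->
  (forall i, (i <= k1)%N -> reg (-1) (st i 0 y)) ->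
  (forall i, (i <= k2)%N -> reg (-1) (pi (-1) ^+ i * st (k1 + i) 0 y)) ->
  (m <= k1 + k2)%N ->
  reg (-1) (pi (-1) ^ (- E0) * boundary_sum mu e a lam y m).
Proof.
move=> E1 E2 r1 r2; have p0 : pi (-1) != 0 by apply: pi_neq0.
have sKn n : sK ^+ n = pi (-1) ^ n * (- pi 1) ^+ n.
  by rewrite -exprMn_comm; [rewrite one_minus_X2E; congr (_ ^+ _); ring|rewrite /GRing.comm mulrC].
have key n : (0 <= n :> int) -> reg (-1) (pi (-1) ^ n).
  by move=> n0; rewrite -(gez0_abs n0) -exprnP; apply: regXn; apply: reg_pi.
elim: m => [|m IH] mk; first by rewrite mulr0; apply: reg0.
rewrite boundary_sumS mulrDr; apply: regD.
  by rewrite mulrCA; apply: regM; [apply: reg_cst|apply: IH; apply: ltnW].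
rewrite sKn -(mulrA (pi (-1) ^ _)) [X in reg _ X]mulrA -expfzDr //.
have rp1 : reg (-1) ((- pi 1) ^+ m.+1) by apply: regXn; apply: regN; apply: reg_pi.
case: (leqP m.+1 k1) => mk1.
  apply: regM; first by apply: key; rewrite addrC subr_ge0 (le_trans E1).
  by apply: regM => //; apply: regM; [apply: r1; apply: ltnW|exact: (r1 m.+1 mk1)].
have mE : m = (k1 + (m - k1))%N by rewrite subnKC.
have mk2 : (m - k1 < k2)%N by rewrite ltn_subLR.
move: mE mk2; set i := (m - k1)%N => mE mk2.
have ri := r2 i (ltnW mk2); have ri' := r2 i.+1 mk2; rewrite addnS -mE in ri'; rewrite -mE in ri.
rewrite [X in reg _ X](_ : _ = pi (-1) ^ (k1%:Z - i%:Z - E0) * ((- pi 1) ^+ m.+1 *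
   ((pi (-1) ^+ i * st m 0 y) * (pi (-1) ^+ i.+1 * st m.+1 0 y)))).
  by apply: regM; [apply: key; lia|apply: regM => //; apply: regM].
set w := (_ - E0)%R; have -> : - E0 + m.+1%:Z = w + i%:Z + i.+1%:Z by rewrite /w; lia.
rewrite !expfzDr // -!exprnP.
by move: (pi (-1) ^ w) (st m.+1 0 y) (st m 0 y) => *; ring.
Qed.

End RegularChain.

(** * From a negative constant to a strictly increasing function *)

Section Positivity.
Variables (F : realFieldType) (K : ratfield F) (al be : F).
Local Notation j := (@rf_inj F K).
Local Notation d := (@rf_d F K).
Local Notation cst := (@rf_cst F K).
Local Notation pi := (@rf_lin F K).
Local Notation sK := (@one_minus_X2 F K).
Local Notation xx := (@rf_X F K).
Local Notation omK := (@weight_dlog F K al be).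
Local Notation Dw := (@weighted_deriv F K al be).
Local Notation p := (pi (-1)).

Lemma ev_exprz c (f : K) v (n : int) : ev c f v -> v != 0 -> ev c (f ^ n) (v ^ n).
Proof.
move=> h v0; case: n => n; first by rewrite -!exprnP; apply: evXn.
by rewrite NegzE -!exprnN; apply: evV; [apply: evXn|rewrite expf_neq0].
Qed.

Lemma reg_ord_ge0 c (n : int) u : unitat c u -> reg c (pi c ^ n * u) -> 0 <= n.
Proof.
move=> stage_coef r; case: (leP 0 n) => // n0; exfalso.
have [m nE] : exists m : nat, n = - m.+1%:Z by case: n n0 {r} => // m _; exists m; rewrite NegzE.
have [v hv] := r; have h1 := evM (evXn m.+1 (ev_pi K c c)) hv.
rewrite nE mulrA exprnP -expfzDr ?pi_neq0 // subrr expr0z mul1r in h1.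
have [w w0 hw] := stage_coef.
by move: w0; rewrite (ev_uniq hw h1) subrr exprS !mul0r eqxx.
Qed.

(** Regularity supplies a different fraction at each point. A coprime pair gives one denominator
    that works at all of them, so that h becomes a genuine function on the interval. *)
Lemma lowest_terms (h : K) : exists P Q : {poly F},
  [/\ h = j P / j Q, Q != 0 & forall c, reg c h -> Q.[c] != 0].
Proof.
have [P0 [Q0 [Q00 hE]]] := rf_frac h.
have g0 : gcdp P0 Q0 != 0 by rewrite gcdp_eq0 negb_and Q00 orbT.
have PE := divpK (dvdp_gcdl P0 Q0); have QE := divpK (dvdp_gcdr P0 Q0).
set P := P0 %/ _ in PE; set Q := Q0 %/ _ in QE.
have Q0' : Q != 0 by apply: contraNneq Q00 => Q0'; rewrite -QE Q0' mul0r.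
have cop : coprimep P Q by apply: coprimep_div_gcd; rewrite Q00 orbT.
have hPQ : h = j P / j Q.
  have -> : j P = j P0 / j (gcdp P0 Q0) by rewrite -[X in _ = j X / _]PE rmorphM mulfK ?rf_inj_eq0.
  have -> : j Q = j Q0 / j (gcdp P0 Q0) by rewrite -[X in _ = j X / _]QE rmorphM mulfK ?rf_inj_eq0.
  by rewrite hE; field; rewrite !rf_inj_eq0 Q00 g0.
exists P, Q; split=> // c [_ [r [t [t0 hrt _]]]]; apply/negP => /eqP Qc.
have tj := horner_neq0 K t0; have Qj : j Q != 0 by rewrite rf_inj_eq0.
have : P * t = r * Q.
  apply: (@rf_injI _ K); rewrite !rmorphM; move: hrt; rewrite hPQ => /eqP.
  by rewrite eqr_div // => /eqP.
move/(congr1 (horner^~ c)); rewrite !hornerM Qc mulr0 => /eqP.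
rewrite mulf_eq0 (negPf t0) orbF => Pc.
by have := coprimep_root cop Pc; rewrite Qc eqxx.
Qed.

Lemma ev_d_frac c (P Q : {poly F}) : Q.[c] != 0 ->
  ev c (d (j P / j Q)) ((P^`() * Q - P * Q^`()).[c] / Q.[c] ^+ 2).
Proof.
move=> q0; exists (P^`() * Q - P * Q^`()), (Q * Q); split.
- by rewrite hornerM mulf_neq0.
- have qj := horner_neq0 K q0.
  by rewrite rf_dM dV // !rf_dinj rmorphB !rmorphM; field.
by rewrite hornerM expr2.
Qed.

Lemma int_not_neg (x : F) (n : int) : (forall m : nat, x + m.+1%:R != 0) -> n%:~R = - x -> n <= 0.
Proof.
move=> nn E; case: (leP n 0) => // n0; exfalso.
have [m mE] : exists m : nat, n = m.+1%:Z by case: n n0 {E} => [[|m]|m] // _; exists m.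
by have := nn m; rewrite -[m.+1%:R]/(m.+1%:Z%:~R) -mE E subrr eqxx.
Qed.

(** The last clause is the derivative of (1-x)^A (1+x)^B P/Q divided by (1-x)^A (1+x)^B. Without
    real powers it makes sense over any ordered field. *)
Definition increasing_witness (A B : F) (P Q : {poly F}) :=
  [/\ 0 < A, 0 < B, forall x, -1 <= x <= 1 -> Q.[x] != 0 &
   forall x, -1 < x < 1 -> 0 < (- A / (1 - x) + B / (1 + x)) * (P.[x] / Q.[x])
     + (P^`() * Q - P * Q^`()).[x] / Q.[x] ^+ 2].

(** Here z is y_k, and the orders n1, n2 of g at 1 and -1 become A = al + n1 and B = be + n2. As N
    >= k, the reference term does not lower the order of the right side. By [ord_twisted_deriv] only
    the exceptional orders -al at 1 and -be at -1 could escape the bound, so they have to be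
    excluded. *)
Lemma neg_const_witness (k1 k2 k N : nat) (z g : K) (C : F) :
  k = (k1 + k2)%N -> (k <= N)%N -> 0 < al + k%:R + 1 -> 0 < be + k1%:R - k2%:R + 1 ->
  (forall m : nat, al + m.+1%:R != 0) -> (forall m : nat, be + m.+1%:R != 0) ->
  (forall c, -1 < c < 1 -> reg c z) -> reg 1 z -> reg (-1) (p ^+ k2 * z) ->
  reg 1 ((pi 1)^-1 * g) ->
  (forall E0 : int, E0 <= 1 -> E0 <= k1%:Z - k2%:Z + 1 -> reg (-1) (p ^ (- E0) * g)) ->
  Dw g = sK ^+ k * z ^+ 2 - cst C * sK ^+ N -> C < 0 ->
  exists A B P Q, increasing_witness A B P Q.
Proof.
move=> kE kN alk bek aln ben zin z1 zN1 g1 gN1 DgE C0.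
have p10 : pi 1 != 0 by apply: pi_neq0.
have p0 : p != 0 by apply: pi_neq0.
have pp : 0 < (1 - -1 : F) by rewrite opprK addr_gt0.
have rhs_pos c v : -1 < c < 1 -> 0 < (1 - c ^+ 2) ^+ k * v ^+ 2 - C * (1 - c ^+ 2) ^+ N.
  move=> c1; have s0 : 0 < 1 - c ^+ 2 by nra.
  have h1 : 0 <= (1 - c ^+ 2) ^+ k * v ^+ 2 by rewrite mulr_ge0 ?sqr_ge0 // exprn_ge0 // ltW.
  have h2 : 0 < - C * (1 - c ^+ 2) ^+ N by rewrite mulr_gt0 ?oppr_gt0 // exprn_gt0.
  by rewrite -[- (C * _)]mulNr; exact: ltr_wpDl h1 h2.
have ev_rhs c v : ev c z v ->
    ev c (sK ^+ k * z ^+ 2 - cst C * sK ^+ N) ((1 - c ^+ 2) ^+ k * v ^+ 2 - C * (1 - c ^+ 2) ^+ N).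
  move=> hv; apply: evB; apply: evM; try exact: ev_cst; try exact: evXn.
    by apply: evXn; apply: ev_one_minus_X2.
  by apply: evXn; apply: ev_one_minus_X2.
have c0 : -1 < (0 : F) < 1 by rewrite ltr01 oppr_lt0 ltr01.
have g0 : g != 0.
  apply/eqP => g0; have [v hv] := zin 0 c0; have := rhs_pos 0 v c0.
  have := ev_rhs 0 v hv; rewrite -DgE g0 weighted_deriv0 => /(ev_uniq (ev0 K 0)) <-.
  by rewrite ltxx.
have [n1 [u1 [uu1 gE1 n1p]]] : exists n u, [/\ unitat 1 u, g = pi 1 ^ n * u & 0 < al + n%:~R].
  have h : Dw g = pi 1 ^ k * ((- p) ^+ k * z ^+ 2 - cst C * (- p) ^+ k * sK ^+ (N - k)).
    rewrite DgE -exprnP -{1}(subnKC kN) exprD.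
    have -> : sK ^+ k = pi 1 ^+ k * (- p) ^+ k by rewrite -exprMn one_minus_X2E; congr (_ ^+ _); ring.
    by ring.
  have [||//|[n [u [stage_coef gE nE]]]|[n [u [stage_coef gE nE]]]] := ord_twisted_deriv _ _ h.
  - by apply: regM; [apply: reg_cst|apply: regV; apply: unit_pi; rewrite -subr_eq0 gt_eqF].
  - have rp : reg 1 (- p) by apply: regN; apply: reg_pi.
    apply: regB; first by apply: regM; apply: regXn.
    by apply: regM; [apply: regM; [apply: reg_cst|apply: regXn]|apply: regXn; apply: reg_one_minus_X2].
  - by move=> gz; rewrite gz eqxx in g0.
  (* The exceptional order -al would be at most 0 by (A1), but g vanishes at 1. *)
  - have := int_not_neg aln nE; have : 0 <= n - 1.
      apply: (reg_ord_ge0 stage_coef); move: g1; rewrite gE mulrA -exprN1 -expfzDr //.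
      by rewrite addrC.
    by rewrite subr_ge0 => n1 /(le_trans n1); rewrite ler10.
  exists n, u; split=> //; apply: lt_le_trans alk _; rewrite -addrA lerD2l.
  by rewrite -[k%:R + 1](intrD _ k 1) ler_int.
have [n2 [u2 [uu2 gE2 n2p]]] : exists n u, [/\ unitat (-1) u, g = p ^ n * u & 0 < be + n%:~R].
  (* With a pole of z of order at most k2, (1-x^2)^k z^2 yields the exponent k - 2 k2 = k1 - k2,
     which may be negative. *)
  have h : Dw g = p ^ (k1%:Z - k2%:Z) * ((- pi 1) ^+ k * (p ^+ k2 * z) ^+ 2
      - cst C * (- pi 1) ^+ N * p ^+ (N + k2 - k1)).
    rewrite DgE expfzDr // -exprnN -exprnP.
    have sKn m : sK ^+ m = p ^+ m * (- pi 1) ^+ m.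
      by rewrite -exprMn one_minus_X2E; congr (_ ^+ _); ring.
    have -> : sK ^+ N = p ^+ (N + k2 - k1) * p ^+ k1 / p ^+ k2 * (- pi 1) ^+ N.
      rewrite sKn; congr (_ * _); apply: (mulIf (expf_neq0 k2 p0)).
      rewrite mulfVK ?expf_neq0 // -!exprD; congr (_ ^+ _).
      by rewrite subnK //; apply: leq_trans (leq_addr _ _); apply: leq_trans kN; rewrite kE leq_addr.
    rewrite sKn {1}kE exprD.
    by field; rewrite expf_neq0.
  rewrite /weighted_deriv /weight_dlog [cst al / _ + _]addrC in h.
  have [||//|[n [u [stage_coef gE nE]]]|[n [u [stage_coef gE nE]]]] := ord_twisted_deriv _ _ h.
  - by apply: regM; [apply: reg_cst|apply: regV; apply: unit_pi; rewrite -subr_eq0 -opprB oppr_eq0 gt_eqF].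
  - have rp : reg (-1) (- pi 1) by apply: regN; apply: reg_pi.
    apply: regB; first by apply: regM; apply: regXn.
    by apply: regM; [apply: regM; [apply: reg_cst|apply: regXn]|apply: regXn; apply: reg_pi].
  - by move=> gz; rewrite gz eqxx in g0.
  (* The exceptional order n = -be is at most 0. If k2 <= k1, the bound n >= 1 refutes it; otherwise
     n >= k1 - k2 + 1 contradicts be + k1 - k2 + 1 > 0. *)
  - have nle := int_not_neg ben nE.
    have hE (E0 : int) : E0 <= 1 -> E0 <= k1%:Z - k2%:Z + 1 -> E0 <= n.
      move=> E1 E2; rewrite -subr_ge0; apply: (reg_ord_ge0 stage_coef).
      by move: (gN1 E0 E1 E2); rewrite gE mulrA -expfzDr // addrC.
    have [k12|k12] := leqP k2 k1.
      have h1 : 1 <= k1%:Z - k2%:Z + 1 by clear -k12; lia.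
      by have := le_trans (hE 1 (lexx _) h1) nle; rewrite ler10.
    have := hE (k1%:Z - k2%:Z + 1) _ (lexx _) => kn; exfalso.
    have {}kn : k1%:Z - k2%:Z + 1 <= n by apply: kn; clear -k12; lia.
    move: bek; rewrite (_ : be = - n%:~R); last by rewrite nE opprK.
    have : (k1%:Z - k2%:Z + 1)%:~R <= n%:~R :> F by rewrite ler_int.
    rewrite !rmorphD rmorphN /= -!pmulrn; lra.
  exists n, u; split=> //; apply: lt_le_trans bek _; rewrite -!addrA lerD2l.
  have : (k1%:Z - k2%:Z + 1)%:~R <= n%:~R :> F by rewrite ler_int.
  by rewrite !rmorphD rmorphN /= -!pmulrn addrA.
(* Inside the interval the residue is 0 and the right side is regular: the exceptional order is 0
   and the other case gives order at least 1, so g has no pole. *)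
have gin c : -1 < c < 1 -> reg c g.
  move=> c1; have [v hv] := zin c c1.
  have cp : c != 1 by case/andP: c1 => _ h; rewrite lt_eqF.
  have cn : c != -1 by case/andP: c1 => h _; rewrite gt_eqF.
  have omr : reg c omK.
    by apply: regD; apply: regM; try exact: reg_cst; apply: regV; apply: unit_pi.
  have rr : reg c (Dw g) by rewrite DgE; exists ((1 - c ^+ 2) ^+ k * v ^+ 2 - C * (1 - c ^+ 2) ^+ N); apply: ev_rhs.
  have [||[n [u [stage_coef gE nE]]]|[n [u [stage_coef gE nE]]]] := @ord_twisted_deriv F K c 0 omK g 0 _ omr rr.
  - by rewrite cst0 mul0r add0r expr0z mul1r.
  - by move=> ->; apply: reg0.
  - have -> : g = u.
      by move/eqP: nE; rewrite oppr0 intr_eq0 => /eqP n0; rewrite gE n0 expr0z mul1r.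
    exact: unitat_reg.
  have n0 : 0 <= n by apply: le_trans nE; rewrite add0r.
  by rewrite gE -(gez0_abs n0) -exprnP; apply: regM; [apply: regXn; apply: reg_pi|apply: unitat_reg].
(* 1 - x instead of x - 1, so that the base of the power is positive on (-1,1). *)
pose w1 := - pi 1; have w10 : w1 != 0 by rewrite oppr_eq0.
have ew c : ev c w1 (1 - c) by rewrite -opprB; apply: evN; apply: ev_pi.
have ep c : ev c p (1 + c) by have := ev_pi K (-1) c; rewrite opprK addrC.
pose h := w1 ^ (- n1) * p ^ (- n2) * g.
have gh : g = w1 ^ n1 * p ^ n2 * h.
  rewrite /h mulrA mulrACA -!expfzDr //.
  by rewrite !subrr !expr0z !mul1r.
have rh c : -1 <= c <= 1 -> reg c h.
  move=> /andP[cl cu]; have [c1|cn1] := eqVneq c 1.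
    rewrite c1 /h gE1 mulrACA.
    have -> : w1 ^ (- n1) * pi 1 ^ n1 = (-1) ^ n1.
      have -> : pi 1 = (-1) * w1 by rewrite /w1; ring.
      by rewrite expfzMl mulrCA -expfzDr // addNr expr0z mulr1.
    apply: regM; last by apply: regM; apply: unitat_reg => //; apply: unitat_exprz; exists (1 + 1) => //; rewrite gt_eqF // addr_gt0.
    apply: unitat_reg; apply: unitat_exprz; exists (-1); first by rewrite oppr_eq0 oner_eq0.
    by rewrite -cst1 -cstN; apply: ev_cst.
  have [c1|cnN1] := eqVneq c (-1).
    rewrite c1 /h gE2 -mulrA (mulrA (p ^ _)) -expfzDr // addNr expr0z mul1r.
    apply: regM; apply: unitat_reg => //; apply: unitat_exprz; exists (1 - -1) => //.
    by rewrite gt_eqF.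
  have c1 : -1 < c < 1 by rewrite !lt_neqAle cl cu cn1 eq_sym cnN1.
  have {}c1' := c1; case/andP: c1' => lc cl'.
  apply: regM; last exact: gin.
  apply: regM; apply: unitat_reg; apply: unitat_exprz.
    by exists (1 - c) => //; rewrite subr_eq0 eq_sym.
  by exists (1 + c) => //; rewrite gt_eqF // -ltrBlDl sub0r.
clearbody h; have [P [Q [hPQ Q0 hQ]]] := lowest_terms h.
exists (al + n1%:~R), (be + n2%:~R), P, Q; split=> // [x x1|x x1].
  by apply: hQ; apply: rh.
have x1' : -1 <= x <= 1 by case/andP: x1 => *; apply/andP; split; apply: ltW.
have Qx := hQ x (rh x x1').
have [lx xl] := andP x1.
have wx : 0 < 1 - x by rewrite subr_gt0.
have px : 0 < 1 + x by rewrite -ltrBlDl sub0r.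
have E : d h + (- cst (al + n1%:~R) / w1 + cst (be + n2%:~R) / p) * h
    = (sK ^+ k * z ^+ 2 - cst C * sK ^+ N) * (w1 ^ (- n1) * p ^ (- n2)).
  have h0 : h != 0 by apply: contraNneq g0 => h0; rewrite gh h0 mulr0.
  have wz n : w1 ^ n != 0 by rewrite expfz_neq0.
  have pz n : p ^ n != 0 by rewrite expfz_neq0.
  rewrite -DgE /weighted_deriv -[d g](mulfVK g0) -mulrDl {1 2}gh !dlogM ?mulf_neq0 //.
  rewrite !dlogXz // -!invr_expz [g in RHS]gh /weight_dlog.
  have -> : d w1 = -1 by rewrite /w1 dN d_pi.
  have -> : pi 1 = - w1 by rewrite opprK.
  rewrite d_pi !cstD (_ : cst n1%:~R = n1%:~R); last by rewrite /rf_cst !rmorph_int.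
  rewrite (_ : cst n2%:~R = n2%:~R); last by rewrite /rf_cst !rmorph_int.
  move: (w1 ^ n1) (p ^ n2) (wz n1) (pz n2) => W1 PP W0 P0.
  by clearbody w1; field; rewrite oppr_eq0 W0 P0 w10 p0 h0.
have [v hv] := zin x x1.
have R := evM (ev_rhs x v hv) (evM (ev_exprz (- n1) (ew x) (lt0r_neq0 wx)) (ev_exprz (- n2) (ep x) (lt0r_neq0 px))).
have hx : ev x h (P.[x] / Q.[x]) by exists P, Q.
have dx : ev x (d h) ((P^`() * Q - P * Q^`()).[x] / Q.[x] ^+ 2) by rewrite hPQ; apply: ev_d_frac.
have L := evD dx (evM (evD (evM (evN (ev_cst K x (al + n1%:~R))) (evV (ew x) (lt0r_neq0 wx)))
  (evM (ev_cst K x (be + n2%:~R)) (evV (ep x) (lt0r_neq0 px)))) hx).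
rewrite E in L; rewrite addrC (ev_uniq L R).
apply: mulr_gt0; first exact: rhs_pos.
by apply: mulr_gt0; apply: exprz_gt0.
Qed.

End Positivity.

(** * The constant of the norm identity and its sign *)

Section ChainSign.
Variables (F : realFieldType) (K : ratfield F) (al be : F).
Local Notation j := (@rf_inj F K).
Local Notation d := (@rf_d F K).
Local Notation cst := (@rf_cst F K).
Local Notation pi := (@rf_lin F K).
Local Notation sK := (@one_minus_X2 F K).
Local Notation xx := (@rf_X F K).
Local Notation tauK := (@tau_coef F K al be).
Local Notation Sol := (@is_solution F K al be).
Local Notation Dw := (@weighted_deriv F K al be).
Local Notation p := (pi (-1)).

Definition eigen (m : nat) : F := m%:R * (m%:R + al + be + 1).
(* [beta_den m / beta_num m] is the ratio of the Beta integrals of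
   (1-x^2)^(m+1) w and (1-x^2)^m w over [-1,1]. *)
Definition beta_num (m : nat) : F := (al + be + m%:R * 2 + 2) * (al + be + m%:R * 2 + 3).
Definition beta_den (m : nat) : F := 4 * ((al + m%:R + 1) * (be + m%:R + 1)).

(** Vanishing at both ends. Such corrections can be added to [boundary_sum] without spoiling the
    order bounds at 1 and, since [E0] is at most 1, at -1. *)
Definition tame (g : K) := reg 1 ((pi 1)^-1 * g) /\ reg (-1) (p^-1 * g).

Lemma tameD g h : tame g -> tame h -> tame (g + h).
Proof. by move=> [a b] [a' b']; split; rewrite mulrDr; apply: regD. Qed.
Lemma tame_scale c g : tame g -> tame (cst c * g).
Proof. by move=> [a b]; split; rewrite mulrCA; apply: regM => //; apply: reg_cst. Qed.
Lemma tame0 : tame 0.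
Proof. by split; rewrite mulr0; apply: reg0. Qed.
Lemma tame_one_minus_X2 m y : (forall c, reg c y) -> tame (sK ^+ m.+1 * y).
Proof.
move=> ry; have s0 c : reg c (sK ^+ m) by apply: regXn; apply: reg_one_minus_X2.
have p10 : pi 1 != 0 by apply: pi_neq0.
have p0 : p != 0 by apply: pi_neq0.
split; rewrite exprS {1}one_minus_X2E.
  rewrite [X in reg _ X](_ : _ = - p * (sK ^+ m * y)); last by field.
  by apply: regM; [apply: regN; apply: reg_pi|apply: regM].
rewrite [X in reg _ X](_ : _ = - pi 1 * (sK ^+ m * y)); last by field.
by apply: regM; [apply: regN; apply: reg_pi|apply: regM].
Qed.

Lemma reg_iter_d c l y : reg c y -> reg c (iter l d y).
Proof. by move=> ry; elim: l => //= l; apply: reg_d. Qed.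

Lemma deriv_ode lam (y : K) m : Sol 0 0 lam 0 y ->
  sK * d (d (iter m d y)) + tauK m * d (iter m d y) + (cst lam - cst (eigen m)) * iter m d y = 0.
Proof.
move=> S; elim: m => [|m IH].
  by move: S; rewrite /is_solution !tderiv_twist0 /eigen !mul0r cst0.
rewrite /=; have := congr1 d IH; rewrite d0; move: (iter m d y) => z.
rewrite !rf_dD !rf_dM (dB (cst lam)) !d_cst d_tau_coef => <-.
rewrite tau_coefS d_one_minus_X2; have -> : eigen m.+1 = eigen m + (al + be + 2 + m%:R * 2).
  by rewrite /eigen -[m.+1]addn1 natrD; ring.
by rewrite cstD; ring.
Qed.

(** Differentiation is a Darboux step with v = 0: by [deriv_ode] the derivatives satisfy equations
    with raised parameters, so [darboux_norm] applies at each order. *)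
Lemma deriv_reduction lam (y : K) m : (forall c, reg c y) -> Sol 0 0 lam 0 y ->
  exists2 g, tame g & sK ^+ m * iter m d y ^+ 2 =
    cst (\prod_(i < m) (lam - eigen i)) * y ^+ 2 + Dw g.
Proof.
move=> ry S; elim: m => [|m [g tg IH]].
  by exists 0; [exact: tame0|rewrite big_ord0 cst1 weighted_deriv0 expr0 /=; ring].
exists (cst (lam - eigen m) * g + sK ^+ m.+1 * (iter m d y * iter m.+1 d y)).
  apply: tameD; first exact: tame_scale.
  by apply: tame_one_minus_X2 => c; apply: regM; apply: reg_iter_d.
have := @darboux_norm F K al be m (cst lam - cst (eigen m)) (iter m d y) 0.
rewrite /= !mul0r subr0 addr0 => /(_ (deriv_ode m S)) ->.
by rewrite -cstB -mulrA IH big_ord_recr /= weighted_derivD weighted_deriv_scale cstM; ring.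
Qed.

Lemma beta_step m : exists2 g, tame g &
  cst (beta_num m) * sK ^+ m.+1 = cst (beta_den m) * sK ^+ m + Dw g.
Proof.
(* With b = be - al and c = al + be + 2m + 2, the linear factor b + c x is conjugate to [tau_coef m]
   = b - c x. Their product b^2 - c^2 x^2 is affine in 1-x^2, which yields the numerator c (c+1) and
   the denominator c^2 - b^2. *)
exists (sK ^+ m.+1 * (cst (be - al) + cst (al + be + m%:R * 2 + 2) * xx)).
  apply: tame_one_minus_X2 => c; apply: regD; first exact: reg_cst.
  by apply: regM; [apply: reg_cst|apply: reg_X].
rewrite /weighted_deriv rf_dM rf_dD rf_dM !d_cst dX dXn exprS.
have -> : cst (beta_den m) * sK ^+ m = sK ^+ m * (cst (beta_num m) * sK
   - (tauK m * (cst (be - al) + cst (al + be + m%:R * 2 + 2) * xx)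
      + sK * cst (al + be + m%:R * 2 + 2))).
  rewrite mulrC; congr (_ * _).
  rewrite /beta_num /beta_den /tau_coef /one_minus_X2 !(cstB, cstD, cstM, cst_nat, cst1); ring.
rewrite tau_coef_weight; move: (weight_dlog K al be) (cst (be - al)) (cst _) (cst _) (d sK) => *; ring.
Qed.

Lemma beta_reduction n i : exists2 g, tame g &
  cst (\prod_(l < i) beta_num (n + l)) * sK ^+ (n + i) =
  cst (\prod_(l < i) beta_den (n + l)) * sK ^+ n + Dw g.
Proof.
elim: i => [|i [g tg IH]].
  by exists 0; [exact: tame0|rewrite !big_ord0 weighted_deriv0 addn0; ring].
have [h th hE] := beta_step (n + i).
exists (cst (\prod_(l < i) beta_num (n + l)) * h + cst (beta_den (n + i)) * g).
  by apply: tameD; apply: tame_scale.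
rewrite !big_ord_recr /= (cstM K _ (beta_num _)) (cstM K _ (beta_den _)).
rewrite -mulrA addnS hE mulrDr mulrCA IH weighted_derivD !weighted_deriv_scale; ring.
Qed.

Variables (mu e : nat -> F) (a : nat -> K) (k k1 k2 : nat).
Local Notation st := (@dstage F K e a).
Local Notation psi := (@dseed F K e a).
Hypothesis SolA : forall i, (i < k)%N -> Sol 0 0 (mu i) (e i) (a i).
Hypothesis mu_neq : forall i l, (i < l)%N -> (l < k)%N -> mu l != mu i.
Hypothesis unit1 : forall i, (i < k)%N -> unitat 1 (a i).
Hypothesis kE : k = (k1 + k2)%N.
Hypothesis e1 : forall i, (i < k1)%N -> e i = 0.
Hypothesis e2 : forall i, (k1 <= i < k)%N -> e i = - be.
Hypothesis unitN1 : forall i, (i < k)%N -> unitat (-1) (a i).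
Hypothesis be_neq : forall m, (m < k1)%N -> (0 < k2)%N -> be + m%:R != 0.
Hypothesis regA : forall c i, (i < k)%N -> reg c (a i).
Hypothesis psi_unit : forall c, -1 < c < 1 -> unitat c (\prod_(i < k) psi i).
Hypothesis al_k : 0 < al + k%:R + 1.
Hypothesis be_k : 0 < be + k1%:R - k2%:R + 1.
Hypothesis al_nn : forall m : nat, al + m.+1%:R != 0.
Hypothesis be_nn : forall m : nat, be + m.+1%:R != 0.
Hypothesis no_witness : forall A B P Q, ~ @increasing_witness F A B P Q.

(** Modulo weighted derivatives, (1-x^2)^k y_k^2 = c y^2, L y^2 = ka^2 (1-x^2)^n and B (1-x^2)^n = A
    (1-x^2)^(n+i). Elimination gives the constant C = c ka^2 A/(L B), which differs from c L A B by
    the square of L B/ka. *)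
Lemma chain_sign lam (y : K) n (ka : F) i :
  (forall c, reg c y) -> Sol 0 0 lam 0 y -> iter n d y = cst ka -> ka != 0 ->
  (forall m, (m < n)%N -> lam != eigen m) -> (k <= n + i)%N ->
  0 <= (\prod_(l < k) (lam - mu l)) * (\prod_(l < n) (lam - eigen l)) *
       ((\prod_(l < i) beta_num (n + l)) * (\prod_(l < i) beta_den (n + l))).
Proof.
move=> ry S yn ka0 lame kn.
set c := \prod_(l < k) _; set L := \prod_(l < n) _; set A := \prod_(l < i) _; set B := \prod_(l < i) _.
have L0 : L != 0 by apply/prodf_neq0 => l _; rewrite subr_eq0 lame.
have B0 : B != 0.
  apply/prodf_neq0 => l _; rewrite /beta_den !mulf_neq0 //; first by rewrite gt_eqF ?ltr0n.
    by rewrite -addrA natr1 al_nn.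
  by rewrite -addrA natr1 be_nn.
have p0 := dseed_neq0 SolA mu_neq unit1.
have N1 := dstage_norm SolA (leqnn k) p0 S.
have [g2 t2 N2] := deriv_reduction n ry S.
have [g3 t3 N3] := beta_reduction n i.
rewrite -/c in N1; rewrite -/L yn in N2; rewrite -/A -/B in N3.
pose C := c * ka ^+ 2 * A / (L * B).
have kk1 : (k1 <= k)%N by rewrite kE leq_addr.
suff C0 : 0 <= C.
  have -> : c * L * (A * B) = C * (L * B / ka) ^+ 2.
    by rewrite /C; field; rewrite ka0 L0 B0.
  by rewrite mulr_ge0 // sqr_ge0.
rewrite leNgt; apply/negP => Cn.
pose g := boundary_sum mu e a lam y k - cst (c / L) * g2 - cst (c * ka ^+ 2 / (L * B)) * g3.
have DgE : Dw g = sK ^+ k * st k 0 y ^+ 2 - cst C * sK ^+ (n + i).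
  rewrite /g !weighted_derivD -![- (cst _ * _)]mulNr -!cstN !weighted_deriv_scale N1 !cstN !mulNr.
  have -> : Dw g2 = sK ^+ n * cst ka ^+ 2 - cst L * y ^+ 2 by rewrite N2 addrC addKr.
  have -> : Dw g3 = cst A * sK ^+ (n + i) - cst B * sK ^+ n by rewrite N3 addrC addKr.
  have cV x : cst x^-1 = (cst x)^-1.
    have [->|x0] := eqVneq x 0; first by rewrite invr0 cst0 invr0.
    by apply: (mulfI (_ : cst x != 0)); rewrite ?cst_eq0 // -cstM !divff ?cst_eq0 ?cst1.
  rewrite /C !(cstM, cstX, cV).
  have cL : cst L != 0 by rewrite cst_eq0.
  have cB : cst B != 0 by rewrite cst_eq0.
  by field; rewrite cL cB.
have t23 : tame (- (cst (c / L) * g2) - cst (c * ka ^+ 2 / (L * B)) * g3).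
  by rewrite -!mulNr -!cstN; apply: tameD; apply: tame_scale.
have gE : g = boundary_sum mu e a lam y k + (- (cst (c / L) * g2) - cst (c * ka ^+ 2 / (L * B)) * g3).
  by rewrite /g addrA.
have r1 m : (m <= k1)%N -> reg (-1) (st m 0 y).
  move=> mk; have [_ h _] := phase1_atN1 SolA mu_neq unit1 kE e1 e2 unitN1 be_neq mk; exact: h.
have r2 m : (m <= k2)%N -> reg (-1) (p ^+ m * st (k1 + m) 0 y).
  move=> mk; have [_ h] := phase2_atN1 SolA mu_neq unit1 kE e1 e2 unitN1 be_neq mk; exact: h.
have [] := @neg_const_witness F K al be k1 k2 k (n + i) (st k 0 y) g C kE kn al_k be_k al_nn be_nn.
- move=> x x1; apply: (@reg_dstage_inside F K e a k p0) => //; last exact: psi_unit.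
    by case/andP: x1 => h _; rewrite gt_eqF.
  by move=> l; exact: regA.
- exact: (reg1_dstage SolA mu_neq unit1).
- by rewrite kE; apply: r2.
- rewrite gE mulrDr; apply: regD; last by case: t23.
  by apply: boundary_sum_at1 => l lk; apply: (reg1_dstage SolA mu_neq unit1).
- move=> E0 E1 E2; rewrite gE mulrDr; apply: regD.
    by apply: (@boundary_sum_atN1 F K mu e a lam y k1 k2) => //; rewrite kE.
  have {}t23 := t23.2; rewrite (_ : - E0 = (1 - E0) - 1); last by rewrite addrAC subrr sub0r.
  rewrite expfzDr ?pi_neq0 // exprN1 -mulrA; apply: regM => //.
  rewrite -(gez0_abs (_ : 0 <= 1 - E0)) ?subr_ge0 // -exprnP.
  by apply: regXn; apply: reg_pi.
- exact: DgE.
- exact: Cn.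
by move=> A' [B' [P [Q]]]; apply: no_witness.
Qed.

End ChainSign.

(** * Jacobi polynomials *)

Section JacobiPolynomials.
Variable F : realFieldType.
Implicit Types (r a b : F) (n i l : nat).

Definition gen_binom r i : F := (\prod_(l < i) (r - l%:R)) / i`!%:R.

Lemma fact_neq0 i : i`!%:R != 0 :> F.
Proof. by rewrite pnatr_eq0 -lt0n fact_gt0. Qed.

Lemma gb0 r : gen_binom r 0 = 1. Proof. by rewrite /gen_binom big_ord0 fact0 divr1. Qed.

Lemma gbS r i : i.+1%:R * gen_binom r i.+1 = (r - i%:R) * gen_binom r i.
Proof.
rewrite /gen_binom big_ord_recr factS natrM /=; field.
by rewrite fact_neq0 /= addrC natr1 pnatr_eq0.
Qed.

Lemma gb_prod_shift r i : \prod_(l < i) (r - l%:R) * (r - i%:R) = r * \prod_(l < i) (r - 1 - l%:R).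
Proof.
transitivity (\prod_(l < i.+1) (r - l%:R)); first by rewrite big_ord_recr.
rewrite big_ord_recl subr0; congr (_ * _).
by apply: eq_bigr => l _; rewrite /= /bump add1n -natr1; ring.
Qed.

Lemma gb_down r i : (r - i%:R) * gen_binom r i = r * gen_binom (r - 1) i.
Proof. by rewrite /gen_binom !mulrA -gb_prod_shift; ring. Qed.

Lemma gb_pascal r i : gen_binom (r + 1) i.+1 = gen_binom r i.+1 + gen_binom r i.
Proof.
have i0 : i.+1%:R != 0 :> F by rewrite pnatr_eq0.
apply: (mulfI i0); rewrite mulrDr !gbS -[i.+1]addn1 natrD.
have := gb_down (r + 1) i; rewrite addrK => ->; ring.
Qed.

Definition jterm n i : {poly F} := ('X - 1) ^+ (n - i) * ('X + 1) ^+ i.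
Definition jcoef a b n i := gen_binom (n%:R + a) i * gen_binom (n%:R + b) (n - i).
Definition jac a b n : {poly F} :=
  (2 ^- n)%:P * \sum_(i < n.+1) (jcoef a b n i)%:P * jterm n i.

Lemma derivXn (p : {poly F}) m : (p ^+ m)^`() = m%:R * p^`() * p ^+ m.-1.
Proof. by rewrite derivX_gen || rewrite deriv_exp -mulr_natl mulrA. Qed.

Lemma deriv_jterm n i : (i <= n)%N ->
  (jterm n i)^`() = (n - i)%:R * ('X - 1) ^+ (n - i).-1 * ('X + 1) ^+ i
    + i%:R * ('X - 1) ^+ (n - i) * ('X + 1) ^+ i.-1.
Proof.
move=> ni; rewrite /jterm derivM !derivXn !derivE !(addr0, subr0); ring.
Qed.

Lemma jterm_up n i : (i <= n)%N ->
  ('X + 1) * (jterm n i)^`() = (n - i)%:R * jterm n i.+1 + i%:R * jterm n i.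
Proof.
move=> ni; rewrite deriv_jterm // /jterm subnS.
case: i ni => [|i] ni; first by rewrite !expr0 expr1; ring.
by rewrite /= !exprS; ring.
Qed.

Lemma jterm_down n i : (i < n)%N ->
  ('X - 1) * (jterm n i.+1)^`() = (n - i.+1)%:R * jterm n i.+1 + i.+1%:R * jterm n i.
Proof.
move=> ni; rewrite deriv_jterm // /jterm -(subnSK ni) [(i.+1).-1]/=.
case: (n - i.+1)%N => [|m]; first by rewrite !expr0 expr1; ring.
by rewrite /= !exprS; ring.
Qed.

Lemma jterm_down0 n : ('X - 1) * (jterm n 0)^`() = n%:R * jterm n 0.
Proof.
rewrite deriv_jterm // /jterm subn0; case: n => [|n]; first by rewrite !expr0; ring.
by rewrite /= exprS; ring.
Qed.

(** Equivalent to ((1+x)^b P_n^{a,b})' = (n+b) (1+x)^(b-1) P_n^{a+1,b-1}. On the terms (x-1)^(n-i)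
    (x+1)^i the operator (x+1) d/dx mixes neighbours only, and Pascal's rule matches the
    coefficients. [jac_down] is its mirror at 1. *)
Lemma jac_up a b n :
  ('X + 1) * (jac a b n)^`() + b%:P * jac a b n = (n%:R + b)%:P * jac (a + 1) (b - 1) n.
Proof.
rewrite /jac derivM derivC mul0r add0r mulrCA [b%:P * _]mulrCA -mulrDr [RHS]mulrCA; congr (_ * _).
rewrite raddf_sum /= !mulr_sumr -big_split /=.
transitivity (\sum_(i < n.+1) ((jcoef a b n i * (n - i)%:R)%:P * jterm n i.+1)
   + \sum_(i < n.+1) (((i%:R + b) * jcoef a b n i)%:P * jterm n i)).
  rewrite -big_split /=; apply: eq_bigr => i _.
  rewrite derivM derivC mul0r add0r mulrCA jterm_up -1?ltnS //.
  by rewrite !(polyCM, polyCD) !polyC_natr; ring.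
rewrite big_ord_recr /= subnn mulr0 polyC0 mul0r addr0.
rewrite [X in _ + X]big_ord_recl [RHS]big_ord_recl /= addrCA -big_split /=; congr (_ + _).
  rewrite [RHS]mulrA -polyCM /jcoef !subn0 !gb0 !mul1r add0r.
  congr (_%:P * _); have := gb_down (n%:R + b) n; rewrite addrAC subrr add0r => ->.
  by rewrite addrA.
apply: eq_bigr => i _; rewrite /bump /= add1n -mulrDl [RHS]mulrA -polyCM -polyCD; congr (_%:P * _).
have ni := ltn_ord i; rewrite /jcoef.
have := gbS (n%:R + b) (n - i.+1); rewrite subnSK // => E1.
have E2 := gb_down (n%:R + b) (n - i.+1).
have -> : n%:R + (b - 1) = n%:R + b - 1 by rewrite addrA.
rewrite [n%:R + (a + 1)]addrA gb_pascal.
rewrite [RHS]mulrCA -E2 -mulrA [gen_binom _ (n - i) * _]mulrC E1.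
by rewrite natrB // -[i.+1]addn1 natrD; ring.
Qed.

Lemma jac_down a b n :
  ('X - 1) * (jac a b n)^`() + a%:P * jac a b n = (n%:R + a)%:P * jac (a - 1) (b + 1) n.
Proof.
rewrite /jac derivM derivC mul0r add0r mulrCA [a%:P * _]mulrCA -mulrDr [RHS]mulrCA; congr (_ * _).
rewrite raddf_sum /= !mulr_sumr -big_split /=.
transitivity (\sum_(i < n) ((jcoef a b n i.+1 * i.+1%:R)%:P * jterm n i)
   + \sum_(i < n.+1) (((n - i)%:R + a) * jcoef a b n i)%:P * jterm n i).
  rewrite big_ord_recl [X in _ = _ + X]big_ord_recl addrCA -big_split /=; congr (_ + _).
    rewrite derivM derivC mul0r add0r mulrCA jterm_down0 subn0.
    by rewrite !(polyCM, polyCD) !polyC_natr; ring.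
  apply: eq_bigr => i _; rewrite /bump /= add1n.
  rewrite derivM derivC mul0r add0r mulrCA jterm_down //.
  by rewrite !(polyCM, polyCD) !polyC_natr; ring.
rewrite [X in _ + X]big_ord_recr [RHS]big_ord_recr /= addrA -big_split /=; congr (_ + _); last first.
  rewrite [RHS]mulrA -polyCM /jcoef !subnn !gb0 !mulr1 add0r.
  congr (_%:P * _); have := gb_down (n%:R + a) n; rewrite addrAC subrr add0r => ->.
  by rewrite addrA.
apply: eq_bigr => i _; rewrite -mulrDl [RHS]mulrA -polyCM -polyCD; congr (_%:P * _).
have ni := ltn_ord i; rewrite /jcoef.
have E1 := gbS (n%:R + a) i; have E2 := gb_down (n%:R + a) i.
have -> : n%:R + (a - 1) = n%:R + a - 1 by rewrite addrA.
rewrite [n%:R + (b + 1)]addrA -(subnSK ni) gb_pascal.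
rewrite [RHS]mulrA -E2 subnSK // [gen_binom _ i.+1 * _ * _]mulrAC [gen_binom _ i.+1 * _]mulrC E1.
by rewrite natrB 1?ltnW //; ring.
Qed.

(** Going up and then down returns to P_n^{a,b}, which composes two first-order relations into the
    equation. The factor n + b is multiplied in, never divided out, so it may vanish. *)
Lemma jac_ode a b n :
  (1 - 'X^2) * (jac a b n)^`()^`() + ((b - a)%:P - (a + b + 2)%:P * 'X) * (jac a b n)^`()
    + (n%:R * (n%:R + a + b + 1))%:P * jac a b n = 0.
Proof.
have E1 := jac_up a b n; have := jac_down (a + 1) (b - 1) n.
rewrite addrK subrK => /(congr1 ( *%R (n%:R + b)%:P)).
rewrite mulrDr mulrCA [_ * ((a + 1)%:P * _)]mulrCA.
have -> : (n%:R + b)%:P * (jac (a + 1) (b - 1) n)^`() =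
    (('X + 1) * (jac a b n)^`() + b%:P * jac a b n)^`().
  by rewrite E1 derivM derivC mul0r add0r.
rewrite -E1; move: (jac a b n) => P.
rewrite derivD !derivM derivC derivD derivX derivC => /eqP; rewrite -subr_eq0 => /eqP E.
rewrite -[RHS]oppr0 -E !(polyCM, polyCD, polyCN, polyCB) !polyC_natr.
move: (P^`()^`()) P^`() => *; ring.
Qed.

Lemma jterm_at1 n i : (i <= n)%N -> (jterm n i).[1] = (i == n)%:R * 2 ^+ i.
Proof.
by rewrite /jterm !hornerE subrr expr0n subn_eq0 eqn_leq => ->.
Qed.

Lemma jterm_atN1 n i : (jterm n i).[-1] = (i == 0)%:R * (-1) ^+ n * 2 ^+ n.
Proof.
rewrite /jterm !hornerE addNr expr0n; case: eqP => [->|_] /=; last by rewrite !mulr0 !mul0r.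
by rewrite mulr1 mul1r subn0 -exprMn; congr (_ ^+ _); ring.
Qed.

Lemma jac_at1 a b n : (jac a b n).[1] = gen_binom (n%:R + a) n.
Proof.
rewrite /jac hornerM hornerC horner_sum big_ord_recr /= big1 ?add0r; last first.
  move=> i _; rewrite hornerM hornerC jterm_at1 1?ltnW // ltn_eqF //.
  by rewrite mul0r mulr0.
rewrite hornerM hornerC jterm_at1 // eqxx mul1r /jcoef subnn gb0 mulr1.
by rewrite mulrC mulfK // expf_neq0 // gt_eqF // addr_gt0.
Qed.

Lemma jac_atN1 a b n : (jac a b n).[-1] = (-1) ^+ n * gen_binom (n%:R + b) n.
Proof.
rewrite /jac hornerM hornerC horner_sum big_ord_recl /= big1 ?addr0; last first.
  by move=> i _; rewrite hornerM hornerC jterm_atN1 /= !mul0r mulr0.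
rewrite hornerM hornerC jterm_atN1 eqxx mul1r /jcoef subn0 gb0 mul1r.
by field; rewrite expf_neq0 // gt_eqF // addr_gt0.
Qed.

Lemma gb_neq0 a n : (forall i, (0 < i <= n)%N -> a + i%:R != 0) -> gen_binom (n%:R + a) n != 0.
Proof.
move=> h; rewrite mulf_neq0 ?invr_eq0 ?fact_neq0 //; apply/prodf_neq0 => i _.
have -> : n%:R + a - i%:R = a + (n - i)%:R by rewrite natrB 1?ltnW //; ring.
by apply: h; rewrite subn_gt0 ltn_ord leq_subr.
Qed.

Lemma size_jac a b n : (size (jac a b n) <= n.+1)%N.
Proof.
rewrite /jac mul_polyC; apply: leq_trans (size_scale_leq _ _) _.
apply: leq_trans (size_sum _ _ _) _; apply/bigmax_leqP => i _.
rewrite mul_polyC; apply: leq_trans (size_scale_leq _ _) _.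
apply: leq_trans (size_polyMleq _ _) _.
have -> : 'X - 1 = 'X - 1%:P :> {poly F} by [].
have -> : 'X + 1 = 'X - (-1)%:P :> {poly F} by rewrite polyCN opprK.
by rewrite !size_exp_XsubC addnS /= addSn subnK // -ltnS.
Qed.

End JacobiPolynomials.

(** * Jacobi polynomials as seeds *)

Section JacobiSeeds.
Variables (F : realFieldType) (K : ratfield F) (al be : F).
Local Notation j := (@rf_inj F K).
Local Notation d := (@rf_d F K).
Local Notation cst := (@rf_cst F K).
Local Notation pi := (@rf_lin F K).
Local Notation xx := (@rf_X F K).
Local Notation del := (@tderiv F K).
Local Notation Sol := (@is_solution F K al be).

Lemma jac_ode_rf a b n :
  one_minus_X2 K * d (d (j (jac a b n))) + (cst (b - a) - cst (a + b + 2) * xx) * d (j (jac a b n))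
    + cst (n%:R * (n%:R + a + b + 1)) * j (jac a b n) = 0.
Proof.
rewrite !rf_dinj /one_minus_X2 /rf_cst /rf_X -[RHS](rmorph0 j) -(jac_ode a b n).
move: (_ %:P) (_ %:P) (_ %:P) (jac a b n)^`()^`() (jac a b n)^`() (jac a b n) => *.
by rewrite !(rmorphD, rmorphN, rmorphM, rmorphXn, rmorph1).
Qed.

Lemma jac_solution n : Sol 0 0 (eigen al be n) 0 (j (jac al be n)).
Proof.
rewrite /is_solution !tderiv_twist0 subr0 /tau_coef mul0r addr0 /eigen.
exact: jac_ode_rf.
Qed.

(** Conjugation by (1+x)^(-be) changes the parameter be to -be and shifts the eigenvalue n (n + al -
    be + 1) by -be (al + 1). *)
Lemma jac_solution_twisted n :
  Sol 0 0 ((n%:R - be) * (n%:R + al + 1)) (- be) (j (jac al (- be) n)).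
Proof.
have := jac_ode_rf al (- be) n; move: (j _) => y E.
have p0 : pi (-1) != 0 by apply: pi_neq0.
have dk : d (inv_1pX K) = - inv_1pX K ^+ 2.
  by rewrite /inv_1pX dV // d_pi; field.
rewrite /is_solution /tderiv !rf_dD !rf_dM dk d_cst mul0r add0r subr0 -[RHS]E.
rewrite /tau_coef /one_minus_X2 /inv_1pX mul0r addr0.
have xE : xx = pi (-1) - 1 by rewrite /rf_lin cstN cst1; ring.
rewrite xE !(cstM, cstD, cstB, cstN, cst_nat, cst1).
by move: (d (d y)) (d y) p0; move: (pi (-1)) => q d2 d1 q0; field.
Qed.

(** Iterating [jac_up] gives the l-th derivative of (1+x)^(-be) P_n^{al,-be} in closed form; this is
    the shape of the rows of W that belong to F2. *)
Lemma iter_tderiv_jac l n :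
  pi (-1) ^+ l * iter l (del (- be)) (j (jac al (- be) n)) =
  cst (\prod_(i < l) (n%:R - be - i%:R)) * j (jac (al + l%:R) (- be - l%:R) n).
Proof.
elim: l => [|l IH]; first by rewrite expr0 big_ord0 cst1 addr0 subr0.
rewrite iterS tderiv_linX IH big_ord_recr /= cstM -mulrA.
have E : pi (-1) * d (j (jac (al + l%:R) (- be - l%:R) n)) +
    cst (- be - l%:R) * j (jac (al + l%:R) (- be - l%:R) n) =
    cst (n%:R - be - l%:R) * j (jac (al + l.+1%:R) (- be - l.+1%:R) n).
  have J (P Q : {poly F}) c1 c2 : ('X + 1) * P^`() + c1%:P * P = c2%:P * Q ->
      pi (-1) * d (j P) + cst c1 * j P = cst c2 * j Q.
    move/(congr1 j); rewrite rmorphD !rmorphM rmorphD rmorph1 rf_dinj.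
    by rewrite /rf_lin cstN cst1 opprK.
  have := J _ _ _ _ (jac_up (al + l%:R) (- be - l%:R) n).
  have -> : al + l%:R + 1 = al + l.+1%:R by rewrite -addrA natr1.
  have -> : - be - l%:R - 1 = - be - l.+1%:R by rewrite -natr1; ring.
  by rewrite addrA.
by rewrite -E rf_dM d_cst; ring.
Qed.

Lemma jac_unit1 b n : (forall m : nat, al + m.+1%:R != 0) -> unitat 1 (j (jac al b n)).
Proof.
move=> h; exists (jac al b n).[1]; last exact: ev_inj.
by rewrite jac_at1 gb_neq0 // => -[|i] // _.
Qed.

Lemma jac_unitN1 a b n : (forall i, (0 < i <= n)%N -> b + i%:R != 0) ->
  unitat (-1) (j (jac a b n)).
Proof.
move=> h; exists (jac a b n).[-1]; last exact: ev_inj.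
by rewrite jac_atN1 mulf_neq0 ?gb_neq0 // expf_neq0 // oppr_eq0 oner_eq0.
Qed.

Lemma eigenB m n : eigen al be n - eigen al be m = (n%:R - m%:R) * (n%:R + m%:R + al + be + 1).
Proof. by rewrite /eigen; ring. Qed.

Lemma eigen_neq m n : (forall m : nat, al + be + m.+1%:R != 0) -> m != n ->
  eigen al be n != eigen al be m.
Proof.
move=> h mn; rewrite -subr_eq0 eigenB mulf_neq0 //.
  by rewrite subr_eq0 eqr_nat eq_sym.
have := h (n + m)%N; rewrite -[(n + m).+1]addn1 !natrD => h'.
by apply: contraNneq h' => <-; apply/eqP; ring.
Qed.

(** The n-th derivative is constant by degree. It is nonzero because every earlier derivative is a
    unit at 1: [star_unit] applied to [deriv_ode] passes this on as long as the eigenvalues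
    differ. *)
Lemma jac_derivn n : (forall m : nat, al + m.+1%:R != 0) ->
  (forall m : nat, al + be + m.+1%:R != 0) ->
  exists2 ka, ka != 0 & iter n d (j (jac al be n)) = cst ka.
Proof.
move=> aln abn; have iterE m P : iter m d (j P) = j (iter m deriv P).
  by elim: m => //= m ->; rewrite rf_dinj.
have sz m (P : {poly F}) : (size (iter m deriv P) <= size P - m)%N.
  elim: m => [|m IH]; first by rewrite subn0.
  apply: leq_trans (_ : (size (iter m deriv P)).-1 <= _)%N.
    by rewrite iterS; apply: leq_trans (size_poly _ _) _.
  by rewrite subnS -!subn1 leq_sub2r.
have un m : (m <= n)%N -> unitat 1 (iter m d (j (jac al be n))).
  elim: m => [|m IH] mn; first exact: jac_unit1.
  have mneq : eigen al be n != eigen al be m by rewrite eigen_neq // ltn_eqF.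
  apply: star_unit (deriv_ode m (jac_solution n)) (IH (ltnW mn)) _ => //.
  - by rewrite expr1n subrr.
  - by rewrite -!iterS iterE; apply: reg_inj.
  - exact: reg_tau_coef.
  - by rewrite -iterS iterE; apply: reg_inj.
have := sz n (jac al be n); have := un n (leqnn n); rewrite iterE => u s.
have {}s : (size (iter n deriv (jac al be n)) <= 1)%N.
  by apply: leq_trans s _; rewrite leq_subLR addn1 size_jac.
have E := size1_polyC s; exists (iter n deriv (jac al be n))`_0; last by rewrite {1}E.
by apply: contraNneq (unitat_neq0 u) => c0; rewrite E c0 polyC0 rmorph0.
Qed.

End JacobiSeeds.

(** * The determinant Omega *)

Section ListPolynomials.
Local Notation R := Rdefinitions.R.
Implicit Types (p q : list R) (r x a b : R).

Lemma List_mapE (A B : Type) (f : A -> B) (s : list A) : List.map f s = map f s.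
Proof. by elim: s => //= y s ->. Qed.
Lemma List_seqE m n : List.seq m n = iota m n.
Proof. by elim: n m => //= n IH m; rewrite IH. Qed.
Lemma List_nthE (A : Type) (y : A) s i : List.nth i s y = nth y s i.
Proof. by elim: s i => [|z s IH] [|i] //=; rewrite IH. Qed.
Lemma List_lengthE (A : Type) (s : list A) : List.length s = size s.
Proof. by elim: s => //= y s ->. Qed.

Lemma prodR_seqE (f : nat -> R) n : prodR (List.map f (List.seq 0 n)) = \prod_(i < n) f i.
Proof.
rewrite List_seqE List_mapE -(big_mkord xpredT f) /index_iota subn0.
by elim: (iota 0 n) => [|i s IH] /=; rewrite ?big_nil // big_cons -IH.
Qed.

Lemma pochE a n : poch a n = \prod_(i < n) (a + i%:R).
Proof. by rewrite /poch prodR_seqE; apply: eq_bigr => i _; rewrite INRE. Qed.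

Lemma gbinomE a n : gbinom a n = gen_binom a n.
Proof.
rewrite /gbinom /gen_binom prodR_seqE RdivE INRE factE; congr (_ / _).
by apply: eq_bigr => i _; rewrite INRE.
Qed.

Lemma pevalE p x : peval p x = (Poly p).[x].
Proof.
elim: p => [|c p IH] /=; first by rewrite horner0.
by rewrite horner_cons IH RplusE RmultE addrC mulrC.
Qed.

Lemma Poly_cons r p : Poly (r :: p) = r%:P + 'X * Poly p.
Proof. by rewrite /= cons_poly_def addrC mulrC. Qed.

Lemma Poly_padd p q : Poly (padd p q) = Poly p + Poly q.
Proof.
elim: p q => [|r p IH] [|t q] /=; rewrite ?add0r ?addr0 //.
by rewrite !cons_poly_def IH RplusE rmorphD /=; ring.
Qed.

Lemma Poly_pscale r p : Poly (pscale r p) = r%:P * Poly p.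
Proof.
elim: p => [|t p IH] /=; first by rewrite mulr0.
by rewrite !cons_poly_def -/(pscale r p) IH RmultE rmorphM /=; ring.
Qed.

Lemma Poly_pmul p q : Poly (pmul p q) = Poly p * Poly q.
Proof.
elim: p => [|t p IH] /=; first by rewrite mul0r.
by rewrite Poly_padd Poly_pscale Poly_cons IH cons_poly_def polyC0; ring.
Qed.

Lemma Poly_ppow p n : Poly (ppow p n) = Poly p ^+ n.
Proof.
elim: n => [|n IH] /=; first by rewrite cons_poly_def mul0r add0r.
by rewrite Poly_pmul IH exprS.
Qed.

Lemma Poly_psum (ps : list Defs.poly) : Poly (psum ps) = \sum_(p <- ps) Poly p.
Proof.
elim: ps => [|p ps IH]; first by rewrite big_nil.
by rewrite big_cons -IH -Poly_padd.
Qed.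

Lemma Poly_psum_seq (f : nat -> Defs.poly) n :
  Poly (psum (List.map f (List.seq 0 n))) = \sum_(i < n) Poly (f i).
Proof.
by rewrite Poly_psum List_mapE big_map List_seqE -(big_mkord xpredT (fun i => Poly (f i))) /index_iota subn0.
Qed.

Lemma nth_pderiv_aux k p i : (pderiv_aux k p)`_i = (k + i)%:R * p`_i.
Proof.
elim: p k i => [|r p IH] k [|i] //=; rewrite ?mulr0 //.
  by rewrite RmultE INRE addn0.
by rewrite IH addSnnS.
Qed.

Lemma Poly_pderiv p : Poly (pderiv p) = (Poly p)^`().
Proof.
apply/polyP => i; rewrite coef_deriv !coef_Poly nth_pderiv_aux add1n mulr_natl.
by case: p => //=; rewrite nth_nil.
Qed.

Lemma Poly_pderivn n p : Poly (pderivn n p) = iter n deriv (Poly p).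
Proof. by elim: n => //= n IH; rewrite Poly_pderiv IH. Qed.

Lemma Poly_X_minus_1 : Poly pX_minus_1 = 'X - 1.
Proof. by rewrite /pX_minus_1 /= !cons_poly_def mul0r add0r mul1r polyCN. Qed.
Lemma Poly_X_plus_1 : Poly pX_plus_1 = 'X + 1.
Proof. by rewrite /pX_plus_1 /= !cons_poly_def mul0r add0r mul1r. Qed.

Lemma Poly_jacobiP a b n : Poly (jacobiP a b n) = jac a b n.
Proof.
rewrite /jacobiP Poly_pscale Poly_psum_seq /jac RinvE RpowE; congr (_ * _).
apply: eq_bigr => i _; rewrite Poly_pscale Poly_pmul !Poly_ppow.
by rewrite Poly_X_minus_1 Poly_X_plus_1 !gbinomE INRE.
Qed.

Lemma Poly_pdivX1 p : Poly p = ('X + 1) * Poly (pdivX1 p).1 + ((pdivX1 p).2)%:P.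
Proof.
elim: p => [|r p IH] /=; first by rewrite mulr0 add0r polyC0.
case E: (pdivX1 p) IH => [q t] /= IH.
by rewrite !cons_poly_def IH RminusE rmorphB /=; ring.
Qed.

Lemma Poly_pdivX1_exact p (Q : {poly R}) : Poly p = ('X + 1) * Q -> Poly (pdivX1 p).1 = Q.
Proof.
move=> E; have D := Poly_pdivX1 p; have r0 : (pdivX1 p).2 = 0.
  have := congr1 (horner^~ (-1)) D; rewrite E !hornerE addNr !mul0r add0r => /esym.
  by [].
have x0 : 'X + 1 != 0 :> {poly R} by rewrite -[1]opprK -[- 1]/(- 1%:P) -polyCN polyXsubC_eq0.
by apply: (mulfI x0); rewrite -E D r0 polyC0 addr0.
Qed.

Lemma Poly_pdivX1n m p (Q : {poly R}) : Poly p = ('X + 1) ^+ m * Q -> Poly (pdivX1n m p) = Q.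
Proof.
elim: m Q => [|m IH] Q; first by rewrite expr0 mul1r.
rewrite exprSr -mulrA => /IH E; rewrite /pdivX1n /= -/(pdivX1n m p).
exact: Poly_pdivX1_exact.
Qed.

Lemma nth_remove_nth (A : Type) (y : A) i s l : (i < size s)%N ->
  nth y (remove_nth i s) l = nth y s (bump i l).
Proof.
rewrite /remove_nth; elim: i s l => [|i IH] [|z s] l //= si.
case: l => [|l] //.
by rewrite bumpS /= -IH.
Qed.

Lemma size_remove_nth (A : Type) i (s : list A) n : (i < n.+1)%N -> size s = n.+1 ->
  size (remove_nth i s) = n.
Proof.
rewrite /remove_nth; elim: i s n => [|i IH] [|z s] n //= si [sn] //.
by case: n si sn => // n si sn; rewrite (IH s n).
Qed.

Definition poly_list_matrix n (M : list (list Defs.poly)) : 'M[{poly R}]_n :=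
  \matrix_(i < n, l < n) Poly (nth [::] (nth [::] M i) l).

Lemma Poly_pdet n M : size M = n -> (forall row, row \in M -> size row = n) ->
  Poly (pdet n M) = \det (poly_list_matrix n M).
Proof.
elim: n M => [|n IH] M sM sr; first by rewrite det_mx00 /= cons_poly_def mul0r add0r.
case: M sM sr => [|row M] // [sM] sr.
have -> : pdet n.+1 (row :: M) = psum (List.map (fun i =>
    pmul (pscale (pow (-1) i) (List.nth i row nil)) (pdet n (List.map (remove_nth i) M)))
    (List.seq 0 n.+1)) by [].
rewrite Poly_psum_seq (expand_det_row _ ord0).
have srow : size row = n.+1 by apply: sr; rewrite mem_head.
apply: eq_bigr => i _; rewrite Poly_pmul Poly_pscale List_nthE !mxE /= /cofactor add0n.
rewrite RpowE; set A := \det _; have -> : Poly (pdet n (List.map (remove_nth i) M)) = A.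
  rewrite IH List_mapE ?size_map //; last first.
    move=> r' /mapP[r'' r''M ->]; apply: size_remove_nth (ltn_ord i) _.
    by apply: sr; rewrite inE r''M orbT.
  congr (\det _); apply/matrixP => l m; rewrite !mxE /=.
  have lM : (l < size M)%N by rewrite sM.
  rewrite (nth_map [::]) // nth_remove_nth //.
  by rewrite (sr (nth [::] M l)) // inE mem_nth ?orbT.
by rewrite rmorphXn /= polyCN; ring.
Qed.

End ListPolynomials.

(** * The matrix W in terms of the seeds *)

Section ExceptionalData.
Local Notation R := Rdefinitions.R.
Variables (K : ratfield R) (al be : R) (F1 F2 : list nat).
Local Notation j := (@rf_inj R K).
Local Notation d := (@rf_d R K).
Local Notation cst := (@rf_cst R K).
Local Notation pi := (@rf_lin R K).
Local Notation del := (@tderiv R K).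
Local Notation Sol := (@is_solution R K al be).
Local Notation p := (pi (-1)).
Let k1 := size F1.
Let k2 := size F2.
Let k := (k1 + k2)%N.

Definition seed_degree i := nth 0%N (F1 ++ F2) i.
Definition seed_twist i : R := if (i < size F1)%N then 0 else - be.
Definition seed_param i : R := if (i < size F1)%N then be else - be.
Definition seed_fun i : K := j (jac al (seed_param i) (seed_degree i)).
Definition seed_eigen i : R :=
  if (i < size F1)%N then eigen al be (seed_degree i)
  else ((seed_degree i)%:R - be) * ((seed_degree i)%:R + al + 1).

Lemma j_X1 : j ('X + 1) = p.
Proof. by rewrite rmorphD rmorph1 /rf_lin cstN cst1 opprK. Qed.

Lemma seed_solution i : (i < k)%N -> Sol 0 0 (seed_eigen i) (seed_twist i) (seed_fun i).
Proof.
move=> _; rewrite /seed_eigen /seed_twist /seed_fun /seed_param; case: ifP => _; first exact: jac_solution.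
exact: jac_solution_twisted.
Qed.

Lemma prod_oppr n (G : 'I_n -> R) : \prod_(i < n) (- G i) = (-1) ^+ n * \prod_(i < n) G i.
Proof.
rewrite (eq_bigr (fun i => -1 * G i)); last by move=> i _; rewrite mulN1r.
by rewrite big_split /= prodr_const card_ord.
Qed.

(** Relative to the Wronskian, W has the factor (1+x)^(k-1) on the rows of F2 and (-1)^l on column
    l, counted from 0. On the rows of F2 the sign arises from (be-f)_l = (-1)^l prod (f-be-i), the
    product in [iter_tderiv_jac]. *)
Lemma W_entry i l : (i < k)%N -> (l < k)%N ->
  j (Poly (nth [::] (nth [::] (Wmat al be F1 F2) i) l)) =
  (if (i < k1)%N then 1 else p ^+ k.-1) * iter l (del (seed_twist i)) (seed_fun i) * cst ((-1) ^+ l).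
Proof.
move=> ik lk; rewrite /Wmat !List_lengthE -/k1 -/k2 plusE -/k !List_mapE.
rewrite nth_cat size_map -/k1 /seed_twist /seed_fun /seed_param -/k1.
have ls : (l < size (iota 1 k))%N by rewrite size_iota.
case: ifP => ik1.
  rewrite (nth_map 0%N) // /W_row1 List_seqE List_mapE (nth_map 0%N) // nth_iota //.
  rewrite Poly_pscale Poly_pderivn Poly_jacobiP RpowE add1n !minusE subSS subn0.
  rewrite /seed_degree nth_cat -/k1 ik1 rmorphM mulrC; congr (_ * _).
  have E : forall P, iter l (del 0) (j P) = j (iter l deriv P).
    by move=> P; elim: (l) => //= m ->; rewrite tderiv_twist0 rf_dinj.
  by rewrite mul1r E.
have k1i : (k1 <= i)%N by rewrite leqNgt ik1.
have ik2 : (i - k1 < k2)%N by rewrite ltn_subLR.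
rewrite (nth_map 0%N) // /W_row2 List_seqE List_mapE (nth_map 0%N) // nth_iota //.
rewrite Poly_pscale Poly_pmul Poly_ppow Poly_X_plus_1 Poly_jacobiP add1n !minusE subSS subn0.
rewrite /seed_degree nth_cat -/k1 ik1; set f := nth _ F2 _.
rewrite pochE rmorphM [j (_ ^+ _ * _)]rmorphM rmorphXn j_X1.
have -> : (k - l.+1)%N = (k.-1 - l)%N by rewrite subnS -subn1 -subnDA addnC subnDA subn1.
have lk' : (l <= k.-1)%N by rewrite -ltnS prednK // (leq_trans _ lk).
have -> : Rminus (Rplus al (INR l.+1)) (IZR 1) = al + l%:R.
  by rewrite INRE RminusE RplusE R1E -natr1; ring.
have -> : Rplus (Rminus (Ropp be) (INR l.+1)) (IZR 1) = - be - l%:R.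
  by rewrite INRE RplusE RminusE RoppE R1E -natr1; ring.
have -> : p ^+ k.-1 = p ^+ (k.-1 - l) * p ^+ l by rewrite -exprD subnK.
have ID := iter_tderiv_jac K al be l f; set X := iter _ _ _ in ID *.
rewrite -(mulrA _ _ X) ID.
have -> : \prod_(i0 < l) (f%:R - be - i0%:R) = (-1) ^+ l * \prod_(i0 < l) (be - f%:R + i0%:R).
  by rewrite -prod_oppr; apply: eq_bigr => i' _; ring.
rewrite INRE -/(cst _) cstM.
have s1 : cst ((-1) ^+ l) * cst ((-1) ^+ l) = 1 by rewrite -cstM -expr2 sqrr_sign cst1.
transitivity (cst (\prod_(i0 < l) (be - f%:R + i0%:R)) * (p ^+ (k.-1 - l) * j (jac (al + l%:R) (- be - l%:R) f))
   * (cst ((-1) ^+ l) * cst ((-1) ^+ l))); first by rewrite s1 mulr1.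
by ring.
Qed.

Lemma det_scale_rows_cols n (r c : 'I_n -> K) (M : 'M[K]_n) :
  \det (\matrix_(i, l) (r i * M i l * c l)) = \prod_i r i * \prod_l c l * \det M.
Proof.
have -> : \matrix_(i, l) (r i * M i l * c l) =
    diag_mx (\row_i r i) *m M *m diag_mx (\row_l c l).
  by apply/matrixP => i l; rewrite mul_mx_diag mul_diag_mx !mxE.
rewrite !det_mulmx !det_diag mulrAC; congr (_ * _ * _); by apply: eq_bigr => i _; rewrite mxE.
Qed.

Lemma prod_if_pow n : \prod_(i < n) (if (i < k1)%N then 1 else p ^+ k.-1) = p ^+ (k.-1 * (n - k1)).
Proof.
elim: n => [|n IH]; first by rewrite big_ord0 muln0.
rewrite big_ord_recr /= IH; case: ltnP => nk; last by rewrite subSn // mulnS exprD mulrC.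
have /eqP E0 : (n - k1 == 0)%N by rewrite subn_eq0 ltnW.
have /eqP E1 : (n.+1 - k1 == 0)%N by rewrite subn_eq0.
by rewrite mulr1 E0 E1.
Qed.

Local Notation psi := (@dseed R K seed_twist seed_fun).

Lemma pdet_dseed : (forall i, (i < k)%N -> psi i != 0) ->
  j (Poly (pdet k (Wmat al be F1 F2))) =
  p ^+ (k.-1 * k2) * cst (\prod_(l < k) (-1) ^+ l) * \prod_(i < k) psi i.
Proof.
move=> p0; rewrite Poly_pdet; first last.
- move=> row; rewrite mem_cat !List_lengthE plusE -/k => /orP[]; rewrite List_mapE => /mapP[f _ ->];
  by rewrite /W_row1 /W_row2 List_mapE size_map List_seqE size_iota.
- by rewrite size_cat !List_mapE !size_map.
rewrite -det_map_mx.
rewrite -(@det_chain R K seed_twist seed_fun k); last by move=> i ik; apply: p0; apply: ltnW.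
have -> : map_mx j (poly_list_matrix k (Wmat al be F1 F2)) = \matrix_(i < k, l < k)
   ((if (i < k1)%N then 1 else p ^+ k.-1) *
     (\matrix_(i < k, l < k) iter l (del (seed_twist i)) (seed_fun i)) i l * cst ((-1) ^+ l)).
  by apply/matrixP => i l; rewrite !mxE W_entry.
rewrite det_scale_rows_cols prod_if_pow addKn; congr (_ * _ * _).
by rewrite /rf_cst rmorph_prod /= rmorph_prod.
Qed.

(** An element regular at -1 has a denominator prime to X + 1, so Gauss's lemma turns the order at
    -1 into divisibility. *)
Lemma dvd_of_unit m (D : {poly R}) (u : K) : reg (-1) u -> j D = p ^+ m * u ->
  exists Q, D = ('X + 1) ^+ m * Q.
Proof.
move=> [_ [r [t [t0 -> _]]]] E; have tj := horner_neq0 K t0.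
have E' : D * t = ('X + 1) ^+ m * r.
  apply: (@rf_injI _ K); rewrite !rmorphM rmorphXn j_X1 E; field; exact: tj.
have : ('X + 1) ^+ m %| D.
  have cop : coprimep (('X + 1) ^+ m) t.
    apply: coprimep_expl; have -> : 'X + 1 = 'X - (-1)%:P :> {poly R} by rewrite polyCN opprK.
    by rewrite coprimep_sym coprimep_XsubC.
  by rewrite -(Gauss_dvdpl _ cop) E' dvdp_mulr.
by move=> /divpK <-; exists (D %/ ('X + 1) ^+ m); rewrite mulrC.
Qed.

End ExceptionalData.

(** * The hypotheses of the theorem on the given seeds *)

Section DataSign.
Local Notation R := Rdefinitions.R.

Lemma StronglySorted_nth_lt (s : list nat) i l : StronglySorted Peano.lt s ->
  (i < l < size s)%N -> (nth 0%N s i < nth 0%N s l)%N.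
Proof.
elim: s i l => [|x s IH] i l; first by rewrite ltn0 andbF.
move=> H; inversion H as [|x' s' Hs Hx]; subst.
case: l => [|l]; first by rewrite ltn0.
case: i => [|i]; rewrite /= !ltnS; last by move=> il; apply: IH.
move=> ls; apply/ssrnat.ltP; move/Forall_forall: Hx; apply.
by rewrite -List_nthE; apply: List.nth_In; rewrite List_lengthE; apply/ssrnat.ltP.
Qed.

Lemma Sorted_nth_lt (s : list nat) i l : Sorted Peano.lt s ->
  (i < l < size s)%N -> (nth 0%N s i < nth 0%N s l)%N.
Proof.
by move=> H; apply: StronglySorted_nth_lt; apply: Sorted_StronglySorted H => x y z; apply: Nat.lt_trans.
Qed.

Lemma List_lastE (s : list nat) : List.last s O = nth 0%N s (size s).-1.
Proof. by elim: s => [|x [|y s] IH] //; rewrite [LHS]IH. Qed.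

Lemma Sorted_le_last (s : list nat) i : Sorted Peano.lt s -> (i < size s)%N ->
  (nth 0%N s i <= List.last s O)%N.
Proof.
move=> H si; rewrite List_lastE; have s0 : (0 < size s)%N by apply: leq_ltn_trans si.
have : (i <= (size s).-1)%N by rewrite -ltnS prednK.
rewrite leq_eqVlt => /orP[/eqP <- //|il]; apply/ltnW/Sorted_nth_lt => //.
by rewrite il ltn_predL.
Qed.

Lemma not_neg_intP (t : R) : not_neg_int t -> forall m : nat, t + m.+1%:R != 0.
Proof.
move=> h m; apply/eqP => E; apply: (h m); rewrite INRE RoppE.
by apply/eqP; rewrite -addr_eq0 E.
Qed.

Variables (K : ratfield R) (al be : R) (F1 F2 : list nat).
Local Notation j := (@rf_inj R K).
Local Notation pi := (@rf_lin R K).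
Local Notation p := (pi (-1)).
Let k1 := size F1.
Let k2 := size F2.
Let k := (k1 + k2)%N.
Local Notation seed_deg := (seed_degree F1 F2).
Local Notation seed := (seed_fun K al be F1 F2).
Local Notation seed_mu := (seed_eigen al be F1 F2).
Local Notation seed_tw := (seed_twist be F1).
Local Notation psi := (@dseed R K seed_tw seed).
Hypothesis S1 : Sorted Peano.lt F1.
Hypothesis S2 : Sorted Peano.lt F2.
Hypothesis aln : forall m : nat, al + m.+1%:R != 0.
Hypothesis ben : forall m : nat, be + m.+1%:R != 0.
Hypothesis abn : forall m : nat, al + be + m.+1%:R != 0.
Hypothesis abn2 : (0 < k2)%N -> forall m : nat, al - be + m.+1%:R != 0.
Hypothesis ben2 : (0 < k2)%N -> forall m : nat, be - (List.last F2 O)%:R + m%:R != 0.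
Hypothesis alk : 0 < al + k%:R + 1.
Hypothesis bek : 0 < be + k1%:R - k2%:R + 1.
Hypothesis Om : forall x, -1 < x < 1 -> (Poly (Omega al be F1 F2)).[x] != 0.
Hypothesis no_witness : forall A B P Q, ~ @increasing_witness R A B P Q.

Let ben_last m : (0 < k2)%N -> (m <= List.last F2 O)%N -> be - m%:R != 0.
Proof.
move=> k20 ml; have := ben2 k20 (List.last F2 O - m); rewrite natrB // => h.
by apply: contraNneq h => E; apply/eqP; rewrite -[RHS]E; ring.
Qed.

Lemma seed_deg_lt1 i l : (i < l)%N -> (l < k1)%N -> (seed_deg i < seed_deg l)%N.
Proof.
move=> il lk; rewrite /seed_degree !nth_cat -/k1 lk (ltn_trans il lk).
by apply: Sorted_nth_lt => //; rewrite il.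
Qed.

Lemma seed_deg_lt2 i l : (k1 <= i)%N -> (i < l)%N -> (l < k)%N -> (seed_deg i < seed_deg l)%N.
Proof.
move=> ki il lk; have kl := leq_trans ki (ltnW il).
rewrite /seed_degree !nth_cat -/k1 (ltnNge i) ki (ltnNge l) kl /=.
by apply: Sorted_nth_lt => //; rewrite ltn_sub2r ?(leq_ltn_trans ki) //= ltn_subLR.
Qed.

Lemma seed_deg_last i : (k1 <= i < k)%N -> (seed_deg i <= List.last F2 O)%N.
Proof.
move=> /andP[ki ik]; rewrite /seed_degree nth_cat -/k1 ltnNge ki /=.
by apply: Sorted_le_last => //; rewrite ltn_subLR.
Qed.

Lemma k2_gt0 i : (k1 <= i < k)%N -> (0 < k2)%N.
Proof. by move=> /andP[ki ik]; rewrite -(ltn_add2l k1) addn0; apply: leq_ltn_trans ki ik. Qed.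

(** The eigenvalue differences factor. Two degrees of F1 involve alpha + beta; a degree g of F1 and
    f of F2 give, up to sign, (be - f + g) (al + f + g + 1); two degrees of F2 involve alpha - beta.
    (A1) and (A2) exclude the zeros of these factors. *)
Lemma seed_mu_neq i l : (i < l)%N -> (l < k)%N -> seed_mu l != seed_mu i.
Proof.
move=> il lk; rewrite /seed_eigen -/k1.
case: (ltnP l k1) => lk1.
  by rewrite (ltn_trans il lk1) eigen_neq // ltn_eqF // seed_deg_lt1.
have lkk : (k1 <= l < k)%N by rewrite lk1.
have k20 := k2_gt0 lkk; rewrite -subr_eq0.
case: (ltnP i k1) => ik1.
  have -> : ((seed_deg l)%:R - be) * ((seed_deg l)%:R + al + 1) - eigen al be (seed_deg i) =
      - ((be - (List.last F2 O)%:R + ((List.last F2 O - seed_deg l + seed_deg i)%N)%:R)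
         * (al + (seed_deg l + seed_deg i).+1%:R)).
    rewrite /eigen -addn1 !natrD natrB ?seed_deg_last //; ring.
  by rewrite oppr_eq0 mulf_neq0 // ben2.
have -> : ((seed_deg l)%:R - be) * ((seed_deg l)%:R + al + 1)
   - ((seed_deg i)%:R - be) * ((seed_deg i)%:R + al + 1) =
   ((seed_deg l)%:R - (seed_deg i)%:R) * (al - be + (seed_deg l + seed_deg i).+1%:R).
  by rewrite -addn1 !natrD; ring.
by rewrite mulf_neq0 ?abn2 // subr_eq0 eqr_nat gtn_eqF // seed_deg_lt2.
Qed.

Lemma seed_unit1 i : (i < k)%N -> unitat 1 (seed i).
Proof. by move=> _; apply: jac_unit1. Qed.

Lemma seed_unitN1 i : (i < k)%N -> unitat (-1) (seed i).
Proof.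
move=> ik; apply: jac_unitN1 => l /andP[l0 li]; rewrite /seed_param -/k1.
case: ltnP => ki; first by case: l l0 {li} => // l _; apply: ben.
have ikk : (k1 <= i < k)%N by rewrite ki.
by rewrite -oppr_eq0 opprD opprK ben_last ?(k2_gt0 ikk) // (leq_trans li) // seed_deg_last.
Qed.

Lemma seed_be_neq m : (m < k1)%N -> (0 < k2)%N -> be + m%:R != 0.
Proof.
move=> _ k20; case: m => [|m]; last exact: ben.
by have := ben_last k20 (leq0n _); rewrite subr0 addr0.
Qed.

Lemma seed_tw1 i : (i < k1)%N -> seed_tw i = 0.
Proof. by rewrite /seed_twist => ->. Qed.
Lemma seed_tw2 i : (k1 <= i < k)%N -> seed_tw i = - be.
Proof. by rewrite /seed_twist -/k1 => /andP[ki _]; rewrite ltnNge ki. Qed.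

Let psi0 i : (i < k)%N -> psi i != 0.
Proof. exact: (dseed_neq0 (@seed_solution K al be F1 F2) seed_mu_neq seed_unit1). Qed.

(* The Wronskian is exactly of order -k1 k2 at -1, which makes the division by
   (1+x)^(k2 (k2-1)) in [Omega] exact. *)
Lemma dseed_prod_unit c : -1 < c < 1 -> unitat c (\prod_(i < k) psi i).
Proof.
move=> c1; pose W := \prod_(i < k) psi i; pose sg : R := \prod_(l < k) (-1) ^+ l.
have sg0 : sg != 0.
  by apply/prodf_neq0 => l _; rewrite expf_neq0 // oppr_eq0 oner_eq0.
have p0 : p != 0 by apply: pi_neq0.
have DE := pdet_dseed psi0; rewrite -/k -/k2 -/W -/sg in DE.
have uW : unitat (-1) (p ^+ (k1 * k2) * W).
  have := prod_dseed_atN1 (@seed_solution K al be F1 F2) seed_mu_neq seed_unit1 (erefl k)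
    seed_tw1 seed_tw2 seed_unitN1 seed_be_neq (leqnn k) (leq_addr _ _).
  by rewrite addKn.
(* The rows of F2 contribute (k-1) k2 factors 1+x, of which k1 k2 cancel the pole of the Wronskian
   at -1. *)
have E : (k.-1 * k2 = k2 * (k2 - 1) + k1 * k2)%N.
  by rewrite /k; case: (k2) => [|m]; rewrite ?muln0 ?addn0 // addnS /= subn1 /= mulnDl addnC (mulnC m).
have [||Q QE] := @dvd_of_unit K (k2 * (k2 - 1)) (Poly (pdet k (Wmat al be F1 F2)))
    (rf_cst K sg * (p ^+ (k1 * k2) * W)).
- by apply: regM; [apply: reg_cst|apply: unitat_reg].
- by rewrite DE E exprD; ring.
have OE : Poly (Omega al be F1 F2) = Q.
  by rewrite /Omega !List_lengthE plusE multE minusE -/k1 -/k2 -/k; apply: Poly_pdivX1n.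
have cN1 : c != -1 by case/andP: c1 => h _; rewrite gt_eqF.
have up : unitat c p by apply: unit_pi.
have uD : unitat c (j (Poly (pdet k (Wmat al be F1 F2)))).
  rewrite QE rmorphM rmorphXn j_X1; apply: unitatM; first exact: unitatXn.
  by exists Q.[c]; [rewrite -OE Om|apply: ev_inj].
have WE : W = j (Poly (pdet k (Wmat al be F1 F2))) / (p ^+ (k.-1 * k2) * rf_cst K sg).
  by rewrite DE; field; rewrite expf_neq0 ?cst_eq0 ?sg0.
rewrite -/W WE; apply: unitatM => //; apply: unitatV; apply: unitatM; first exact: unitatXn.
by exists sg => //; apply: ev_cst.
Qed.

Lemma data_sign n i : (k <= n + i)%N ->
  0 <= (\prod_(l < k) (eigen al be n - seed_mu l)) *
       (\prod_(l < n) (eigen al be n - eigen al be l)) *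
       ((\prod_(l < i) beta_num al be (n + l)) * (\prod_(l < i) beta_den al be (n + l))).
Proof.
move=> kn; have [ka ka0 kaE] := jac_derivn K n aln abn.
apply: (chain_sign (@seed_solution K al be F1 F2) seed_mu_neq seed_unit1 (erefl k)
  seed_tw1 seed_tw2 seed_unitN1 seed_be_neq _ dseed_prod_unit alk bek aln ben no_witness
  _ (jac_solution K al be n) kaE ka0) => //.
- by move=> c l _; apply: reg_inj.
- by move=> c; apply: reg_inj.
by move=> m mn; apply: eigen_neq => //; rewrite ltn_eqF.
Qed.

Lemma seed_mu_prod n : \prod_(l < k) (eigen al be n - seed_mu l) =
  prodR (List.map (fun f => (n%:R - f%:R) * (n%:R + f%:R + al + be + 1)) F1) *
  prodR (List.map (fun f => (n%:R + be - f%:R) * (n%:R + f%:R + al + 1)) F2).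
Proof.
have E (g : nat -> R) (s : list nat) : prodR (List.map g s) = \prod_(l < size s) g (nth 0%N s l).
  rewrite -(big_mkord xpredT (fun l => g (nth 0%N s l))) -(big_nth 0%N xpredT g) List_mapE.
  by elim: s => [|x s IH]; rewrite ?big_nil // big_cons -IH.
rewrite !E big_split_ord /=; congr (_ * _); apply: eq_bigr => l _.
  rewrite /seed_eigen /seed_degree nth_cat ltn_ord eigenB; ring.
rewrite /seed_eigen /seed_degree nth_cat -/k1 ltnNge leq_addr /= addKn /eigen; ring.
Qed.

End DataSign.

(** * The contradiction over the reals and the Gamma factors *)

Local Notation R := Rdefinitions.R.

Lemma derivable_pt_lim_horner (P : {poly R}) x :
  derivable_pt_lim (fun y => P.[y]) x P^`().[x].
Proof.
elim/poly_ind: P => [|P c IH].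
  rewrite deriv0 horner0; apply: (derivable_pt_lim_ext (fct_cte 0)).
    by move=> y; rewrite horner0.
  exact: derivable_pt_lim_const.
apply: (derivable_pt_lim_ext (plus_fct (mult_fct (fun y => P.[y]) Ranalysis1.id) (fct_cte c))).
  by move=> y; rewrite !hornerE.
have -> : (P * 'X + c%:P)^`().[x] =
   Rplus (Rplus (Rmult P^`().[x] (Ranalysis1.id x)) (Rmult P.[x] (IZR 1))) (IZR 0).
  by rewrite derivD derivM derivX derivC !hornerE /Ranalysis1.id !RplusE !RmultE ?R0E ?R1E; ring.
apply: derivable_pt_lim_plus; last exact: derivable_pt_lim_const.
by apply: derivable_pt_lim_mult => //; exact: derivable_pt_lim_id.
Qed.

(** Q has no zero on the closed interval, so P/Q is bounded by compactness. The mean value theorem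
    turns the inequality into strict growth, contrary to [vanishing_ends_not_increasing]. *)
Lemma no_increasing_witness A B P Q : ~ @increasing_witness R A B P Q.
Proof.
move=> [/RltP A0 /RltP B0 Q0 D0].
pose h y : R := Rdiv P.[y] Q.[y].
have Q0' x : Rle (-1) x /\ Rle x 1 -> Q.[x] <> 0.
  by move=> [/RleP x1 /RleP x2]; apply/eqP; apply: Q0; rewrite x1 x2.
have dh x : Rle (-1) x /\ Rle x 1 -> derivable_pt_lim h x ((P^`() * Q - P * Q^`()).[x] / Q.[x] ^+ 2).
  move=> x1; have q0 := Q0' x x1.
  have := derivable_pt_lim_div _ _ _ _ _ (derivable_pt_lim_horner P x) (derivable_pt_lim_horner Q x) q0.
  rewrite /Rsqr RdivE RminusE !RmultE => H.
  by rewrite !hornerE expr2 [P.[x] * _]mulrC; exact: H.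
have [M HM] : exists M, forall x, Rle (-1) x /\ Rle x 1 -> Rle (Rabs (h x)) M.
  have [] := continuity_ab_maj (fun y => Rabs (h y)) (-1) 1; first by Lra.lra.
    move=> c c1; apply: (continuity_pt_comp h Rabs); last exact: Rcontinuity_abs.
    by apply: derivable_continuous_pt; eexists; exact: dh c1.
  by move=> m [Hm _]; exists (Rabs (h m)) => x x1; apply: Hm.
apply: (vanishing_ends_not_increasing A B M h A0 B0 HM) => a b a1 ab b1.
pose G x : R := Rmult (Rmult (Rpower (Rminus 1 x) A) (Rpower (Rplus 1 x) B)) (h x).
change (Rlt (G a) (G b)).
have dG c : Rle a c /\ Rle c b -> derivable_pt_lim G c (Rmult (Rmult (Rpower (Rminus 1 c) A) (Rpower (Rplus 1 c) B))
    (Rplus (Rmult (Rplus (Rdiv (Ropp A) (Rminus 1 c)) (Rdiv B (Rplus 1 c))) (h c)) ((P^`() * Q - P * Q^`()).[c] / Q.[c] ^+ 2))).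
  move=> [ac cb]; apply: derivable_pt_lim_weighted; first by Lra.lra.
  by apply: dh; Lra.lra.
have [c [cE [ac cb]]] := MVT_cor2 G _ a b ab dG.
apply: Rminus_gt_0_lt; rewrite cE; apply: Rmult_lt_0_compat; last by Lra.lra.
apply: Rmult_lt_0_compat; first by apply: Rmult_lt_0_compat; apply: exp_pos.
have c1 : -1 < c < 1.
  by apply/andP; split; apply/RltP; rewrite -?R1E -?RoppE; Lra.lra.
have /RltP := D0 c c1.
by rewrite /h !RplusE !RmultE !RdivE RminusE RoppE R1E.
Qed.

(* [poch] with its argument in [ring_scope]. *)
Definition rise (z : R) n : R := \prod_(i < n) (z + i%:R).
Arguments rise z%_ring_scope n%_nat_scope.

Lemma riseD z m n : rise z (m + n) = rise z m * rise (z + m%:R) n :> R.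
Proof.
rewrite !/rise big_split_ord /=; congr (_ * _); apply: eq_bigr => i _.
by rewrite natrD addrA.
Qed.

Lemma rise1 z : rise z 1 = z :> R.
Proof. by rewrite /rise big_ord_recl big_ord0 addr0 mulr1. Qed.

Lemma eigen_prod (al be : R) n : \prod_(l < n) (eigen al be n - eigen al be l) =
  \prod_(l < n) (n%:R - l%:R) * rise (n%:R + al + be + 1) n.
Proof.
rewrite /rise -big_split /=; apply: eq_bigr => l _.
by rewrite eigenB; ring.
Qed.

Lemma beta_num_prod (al be : R) n i : \prod_(l < i) beta_num al be (n + l) =
  rise (n%:R + n%:R + 2 + al + be) (i + i).
Proof.
elim: i => [|i IH]; first by rewrite big_ord0 /rise big_ord0.
have -> : (i.+1 + i.+1 = (i + i) + 2)%N by rewrite addn2 addnS.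
rewrite big_ord_recr /= IH [RHS]riseD; congr (_ * _).
by rewrite /rise 2!big_ord_recl big_ord0 /beta_num /= /bump /= !natrD; ring.
Qed.

Lemma beta_den_prod (al be : R) n i : \prod_(l < i) beta_den al be (n + l) =
  4 ^+ i * (rise (n%:R + al + 1) i * rise (n%:R + be + 1) i).
Proof.
rewrite !/rise -!big_split /=.
elim: i => [|i IH]; first by rewrite !big_ord0 mulr1.
by rewrite !big_ord_recr /= IH exprS /beta_den natrD; ring.
Qed.

(** To be read with q = 2n+al+be+1, r1 = (n+al+be+1)_n and r3 = (2n+al+be+2)_(2k): the factor q from
    the denominator of H(n) fills the gap, and r1 q r3 is a single Pochhammer product. The variables
    [ga], [gen_binom] and [gs] stand for the Gamma values at n+al+1, n+be+1 and n+al+be+1. *)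
Lemma admissible_sign (c q ga gen_binom gs ra rb r1 r3 : R) :
  q != 0 -> ra != 0 -> rb != 0 -> r1 != 0 -> r3 != 0 ->
  0 <= ga * ra -> 0 <= gen_binom * rb -> 0 <= gs * (r1 * q * r3) ->
  0 <= c * r1 * (r3 * (ra * rb)) -> 0 <= c * (ga * gen_binom / (q * gs)).
Proof.
move=> q0 a0 b0 n1 n3 ha hb hs hc.
(* The inverse of 0 is 0 by convention, so the quotient vanishes in this case. *)
have [->|s0] := eqVneq gs 0; first by rewrite mulr0 invr0 !mulr0.
have -> : c * (ga * gen_binom / (q * gs)) = (c * r1 * (r3 * (ra * rb))) * (ga * ra) * (gen_binom * rb) *
   (gs * (r1 * q * r3)) * ((q * gs * ra * rb * r1 * r3)^-1) ^+ 2.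
  by field; rewrite q0 a0 b0 n1 n3 s0.
exact: mulr_ge0 (mulr_ge0 (mulr_ge0 (mulr_ge0 hc ha) hb) hs) (sqr_ge0 _).
Qed.

Lemma Gamma_sign_rise (z : R) (M : nat) : (forall m : nat, z + m%:R != 0) -> 0 < z + M%:R ->
  0 <= Gamma z * rise z M.
Proof.
move=> h /RltP hM; rewrite /rise -pochE; apply/RleP; apply: Gamma_sign; last by rewrite INRE RplusE.
by move=> m; rewrite INRE RoppE => E; have := h m; rewrite E addNr eqxx.
Qed.

Lemma rise_neq0 (z : R) n : (forall m : nat, z + m%:R != 0) -> rise z n != 0.
Proof. by move=> h; rewrite /rise; apply/prodf_neq0 => i _. Qed.

Lemma jacobi_admissible_of_regular (F1 F2 : list nat) (al be : R) :
  pos_finset F1 -> pos_finset F2 ->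
  condA1 al be -> condA2 al be F2 ->
  Rlt 0 (Rplus (Rplus al (INR (length F1 + length F2))) 1) ->
  Rlt 0 (Rplus (Rminus (Rplus be (INR (length F1))) (INR (length F2))) 1) ->
  (forall x, Rle (-1) x /\ Rle x 1 -> peval (Omega al be F1 F2) x <> 0) ->
  jacobi_admissible al be F1 F2.
Proof.
move=> [S1 _] [S2 _] [hal [hbe hab]] hA2; rewrite !List_lengthE => /RltP hk1 /RltP hk2 hO n.
have [K] := ratfield_exists R.
have aln := not_neg_intP hal; have ben := not_neg_intP hbe.
have abn : forall m : nat, al + be + m.+1%:R != 0 := not_neg_intP hab.
rewrite !RplusE INRE in hk1; rewrite !RplusE RminusE !INRE in hk2.
pose k := (size F1 + size F2)%N.
have alk : 0 < al + k%:R + 1 by [].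
have bek : 0 < be + (size F1)%:R - (size F2)%:R + 1 by [].
have F2n : (0 < size F2)%N -> F2 <> nil by case: (F2).
have abn2 : (0 < size F2)%N -> forall m : nat, al - be + m.+1%:R != 0.
  by move=> /F2n /hA2 [h _]; exact: not_neg_intP h.
(* (A2) excludes be - f - 1 = -(m+1) for the largest f in F2, that is, be - f + m = 0 for every m >=
   0. *)
have ben2 : (0 < size F2)%N -> forall m : nat, be - (List.last F2 O)%:R + m%:R != 0.
  move=> /F2n /hA2 [_ h] m; have := not_neg_intP h m.
  rewrite !RminusE INRE R1E; apply: contraNneq => E; apply/eqP.
  by rewrite -[RHS]E -natr1; ring.
have Om x : -1 < x < 1 -> (Poly (Omega al be F1 F2)).[x] != 0.
  move=> /andP[x1 x2]; apply/eqP; rewrite -pevalE; apply: hO.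
  by split; apply/RleP; rewrite ?R1E; apply: ltW.
(* The exponent is raised by k: then n + k >= k for every n, and the products are long enough to
   make the shifted Gamma arguments positive, as [pa], [pb] and [ps] state. *)
have S := @data_sign K al be F1 F2 S1 S2 aln ben abn abn2 ben2 alk bek Om no_increasing_witness n k (leq_addl _ _).
rewrite seed_mu_prod eigen_prod beta_num_prod beta_den_prod in S.
rewrite /Hfun; apply/RleP; rewrite !RmultE RdivE !RplusE !INRE ?R1E.
set c1 := prodR _ in S; set c2 := prodR _ in S; set c1' := prodR _; set c2' := prodR _.
have e1 : c1' = c1.
  rewrite /c1' /c1; congr prodR; apply: List.map_ext => f.
  by rewrite !RmultE RminusE !RplusE !INRE ?R1E.
have e2 : c2' = c2.
  rewrite /c2' /c2; congr prodR; apply: List.map_ext => f.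
  by rewrite !RmultE RminusE !RplusE !INRE ?R1E.
rewrite e1 e2.
have nab m : n%:R + al + be + 1 + m%:R != 0.
  by have := abn (n + m)%N; rewrite -addn1 !natrD; apply: contraNneq => E; apply/eqP; rewrite -[RHS]E; ring.
have na m : n%:R + al + 1 + m%:R != 0.
  by have := aln (n + m)%N; rewrite -addn1 !natrD; apply: contraNneq => E; apply/eqP; rewrite -[RHS]E; ring.
have nb m : n%:R + be + 1 + m%:R != 0.
  by have := ben (n + m)%N; rewrite -addn1 !natrD; apply: contraNneq => E; apply/eqP; rewrite -[RHS]E; ring.
have n3 m : n%:R + n%:R + 2 + al + be + m%:R != 0.
  by have := nab (n + 1 + m)%N; rewrite !natrD; apply: contraNneq => E; apply/eqP; rewrite -[RHS]E; ring.
have n0 : 0 <= n%:R :> R by apply: ler0n.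
have pa : 0 < n%:R + al + 1 + k%:R by rewrite (_ : _ + _ = n%:R + (al + k%:R + 1)); [apply: ltr_wpDl|ring].
have pb : 0 < n%:R + be + 1 + k%:R.
  rewrite (_ : _ + _ = (n%:R + (size F2)%:R *+ 2) + (be + (size F1)%:R - (size F2)%:R + 1)).
    by apply: ltr_wpDl => //; rewrite addr_ge0 // mulrn_wge0.
  by rewrite /k natrD; ring.
have ps : 0 < n%:R + al + be + 1 + (n + 1 + (k + k))%N%:R.
  by rewrite (_ : _ + _ = (n%:R + al + 1 + k%:R) + (n%:R + be + 1 + k%:R)); [apply: addr_gt0|rewrite !natrD; ring].
apply: (@admissible_sign _ _ _ _ _ (rise (n%:R + al + 1) k) (rise (n%:R + be + 1) k)
  (rise (n%:R + al + be + 1) n) (rise (n%:R + n%:R + 2 + al + be) (k + k))); try exact: rise_neq0.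
- have := nab n; apply: contraNneq => E; apply/eqP; rewrite -[RHS]E.
  by have -> : IZR 2 = 2 by []; ring.
- exact: Gamma_sign_rise.
- exact: Gamma_sign_rise.
- have := Gamma_sign_rise nab ps; rewrite (riseD _ (n + 1)) (riseD _ n 1) rise1.
  have -> : n%:R + al + be + 1 + (n + 1)%N%:R = n%:R + n%:R + 2 + al + be by rewrite natrD; ring.
  have -> // : n%:R + al + be + 1 + n%:R = 2 * n%:R + al + be + 1 by ring.
(* The positive factor n! 4^k is all that separates [S] from the required product. *)
have D0 : 0 < \prod_(l < n) (n%:R - l%:R : R) * 4 ^+ k.
  apply: mulr_gt0; last by apply: exprn_gt0; rewrite ltr0n.
  by apply: prodr_gt0 => l _; rewrite subr_gt0 ltr_nat.
rewrite -(pmulr_rge0 _ D0); apply: le_trans S _.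
by rewrite le_eqVlt; apply/orP; left; apply/eqP; ring.
Qed.

Open Scope R_scope.

Theorem theorem6p2 (F1 F2 : list nat) (alpha beta : R) :
  pos_finset F1 -> pos_finset F2 -> (F1 ++ F2)%list <> nil ->
  condA1 alpha beta -> condA2 alpha beta F2 ->
  alpha + INR (length F1 + length F2)%nat + 1 > 0 ->
  beta + INR (length F1) - INR (length F2) + 1 > 0 ->
  (forall x : R, -1 <= x <= 1 -> peval (Omega alpha beta F1 F2) x <> 0) ->
  jacobi_admissible alpha beta F1 F2.
Proof.
move=> hF1 hF2 _ hA1 hA2 hk1 hk2 hO.
exact: (jacobi_admissible_of_regular hF1 hF2 hA1 hA2 hk1 hk2 hO).
Qed.
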